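(* Let $A$ be an approximately unital Jordan operator algebra, let $X$ be a nondegenerate (left) Jordan Banach $A$-module (resp. nondegenerate Jordan Banach $A$-bimodule), and let $b \in X$. Then there exist an element $b_0 \in X$ and an element $a \in {\mathfrak F}_A$ with $b = a b_0$ (resp. $b = a b_0 a$). Moreover, if $\Vert b \Vert < 1$ then $b_0$ and $a$ may be chosen of norm $< 1$. Also, $b_0$ may be chosen to be in the closure of $\{ cb : c \in A \}$ (resp. of $\{ c b c : c \in A \}$).
   Context: A Jordan operator algebra is a norm-closed subspace $A$ of $B(H)$ ($H$ a complex Hilbert space) closed under $a\circ b=\frac12(ab+ba)$. Its unitization $A^1$ is $A+\mathbb{C}I_H$ if $A$ is nonunital (unique up to isometric Jordan isomorphism), and $A$ itself if $A$ is unital. A partial cai for $A$ is a net $(e_t)$ of contractions in $A$ such that in every $C^*$-algebra containing $A$ as a Jordan subalgebra, $e_ta\to a$ and $ae_t\to a$ for all $a\in A$; $A$ is approximately unital if it has a partial cai. ${\mathfrak F}_A=\{a\in A:\|1-a\|\le1\}$ (norm and $1$ in $A^1$). A left Jordan Banach $A$-premodule is a Banach space $X$ with a contractive bilinear map $A\times X\to X$, $(a,x)\mapsto ax$; right premodules are defined similarly. A Jordan Banach $A$-prebimodule is both a left and a right premodule with $a(xb)=(ax)b$ for all $a,b\in A$, $x\in X$. $X$ is nondegenerate if $e_tx\to x$ for all $x\in X$ (and in the prebimodule case also $xe_t\to x$), where $(e_t)$ is a partial cai for $A$. A nondegenerate premodule (prebimodule) is a premodule (prebimodule) over $A^1$ for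 the natural unital extension of the action(s). Such $X$ is a (left) Jordan Banach $A$-module if moreover $(a_1a_2\cdots a_m)x=a_1(a_2(\cdots(a_mx)\cdots))$ for all $m\in\mathbb{N}$, $x\in X$ and all $a_1,\dots,a_m\in A^1$ such that $a_1a_2\cdots a_m\in A^1$, where the product $a_1\cdots a_m$ is the one in some fixed $C^*$-algebra containing $A^1$ as a Jordan subalgebra. A Jordan Banach $A$-bimodule is a prebimodule satisfying this condition and the analogous condition $x(a_1\cdots a_m)=((\cdots(xa_1)a_2)\cdots)a_m$ for the right action. *)

(* Defs.v *)
From HB Require Import structures.
From mathcomp Require Import all_boot all_order all_algebra.
From mathcomp Require Import sesquilinear.
From mathcomp Require Import all_classical all_reals topology normedtype.
From mathcomp Require Import complex.

Set Implicit Arguments.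
Unset Strict Implicit.
Unset Printing Implicit Defensive.

Import Order.TTheory GRing.Theory Num.Theory.
Import numFieldNormedType.Exports.

Local Open Scope classical_set_scope.
Local Open Scope ring_scope.
Local Open Scope complex_scope.

(* A form in [{dot _ for _}] is linear in its first argument and
   conjugate-linear in its second. *)
HB.mixin Record isHilbert (R : realType) H & CompleteNormedModule R[i] H := {
  inner : {dot H for @conjc R};
  inner_norm : forall x : H, inner x x = `|x| ^+ 2
}.

#[short(type="hilbertType")]
HB.structure Definition Hilbert (R : realType) :=
  {H of CompleteNormedModule R[i] H & isHilbert R H}.

(* C*-algebras are not required to have a unit, so the product is not the one
   of a ring structure. *)
HB.mixin Record isCstarAlgebra (R : realType) D
    & CompleteNormedModule R[i] D := {
  cmul : D -> D -> D;
  cstar : D -> D;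
  cmulA : associative cmul;
  cmulDl : left_distributive cmul +%R;
  cmulDr : right_distributive cmul +%R;
  cmulZl : forall (z : R[i]) (x y : D), cmul (z *: x) y = z *: cmul x y;
  cmulZr : forall (z : R[i]) (x y : D), cmul x (z *: y) = z *: cmul x y;
  cnormM : forall x y : D, `|cmul x y| <= `|x| * `|y|;
  cstarK : involutive cstar;
  cstarD : {morph cstar : x y / x + y};
  cstarZ : forall (z : R[i]) (x : D), cstar (z *: x) = (z^*)%C *: cstar x;
  cstarM : forall x y : D, cstar (cmul x y) = cmul (cstar y) (cstar x);
  cstar_norm : forall x : D, `|cmul (cstar x) x| = `|x| ^+ 2
}.

#[short(type="cstarAlgType")]
HB.structure Definition CstarAlgebra (R : realType) :=
  {D of CompleteNormedModule R[i] D & isCstarAlgebra R D}.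

Section BoundedOperators.
Context {R : realType} {H : hilbertType R}.

Definition is_bounded_op (f : H -> H) : Prop :=
  linear f /\ exists M : R[i], forall x, `|f x| <= M * `|x|.

Definition bounded_op_pred : {pred H -> H} := fun f => `[< is_bounded_op f >].

Lemma bounded_op_predP f : reflect (is_bounded_op f) (f \in bounded_op_pred).
Proof. exact: asboolP. Qed.

Lemma bounded_op_submod : submod_closed bounded_op_pred.
Proof.
split=> [|z f g /bounded_op_predP[lf [M fM]] /bounded_op_predP[lg [N gN]]].
  apply/bounded_op_predP; split=> [a x y|]; first by rewrite scaler0 addr0.
  by exists 0 => x; rewrite normr0 mul0r.
apply/bounded_op_predP; split=> [a x y|].
  rewrite !fctE lf lg !scalerDr !scalerA (mulrC z) -!addrA; congr (_ + _).
  by rewrite addrCA.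
exists (`|z| * M + N) => x; rewrite mulrDl -mulrA.
by rewrite (le_trans (ler_normD _ _))// lerD// normrZ ler_wpM2l.
Qed.

HB.instance Definition _ :=
  GRing.isSubmodClosed.Build R[i] (H -> H) bounded_op_pred bounded_op_submod.

End BoundedOperators.

Record bounded_op (R : realType) (H : hilbertType R) := BoundedOp {
  bop_fun :> H -> H;
  bop_funP : bop_fun \in bounded_op_pred
}.

Section BoundedOperatorAlgebra.
Context {R : realType} {H : hilbertType R}.

HB.instance Definition _ := [isSub for @bop_fun R H].
HB.instance Definition _ := [Choice of bounded_op H by <:].
HB.instance Definition _ := [SubChoice_isSubLmodule of bounded_op H by <:].

Implicit Types f g h : bounded_op H.

Lemma bounded_opP f : is_bounded_op f.
Proof. exact/bounded_op_predP/bop_funP. Qed.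

HB.instance Definition _ f :=
  GRing.isLinear.Build R[i] H H *:%R f (bounded_opP f).1.

Lemma bop_eq f g : f =1 g -> f = g.
Proof. by move=> fg; apply/val_inj/funext. Qed.

Lemma bopD f g x : (f + g) x = f x + g x. Proof. by []. Qed.

Lemma bopZ (z : R[i]) f x : (z *: f) x = z *: f x. Proof. by []. Qed.

Lemma bop_id_subproof : (idfun : H -> H) \in bounded_op_pred.
Proof. by apply/bounded_op_predP; split=> //; exists 1 => x; rewrite mul1r. Qed.

Lemma normr_ReE (V : normedModType R[i]) (x : V) : `|x| = (complex.Re `|x|)%:C.
Proof. by apply/esym/RRe_real; rewrite ger0_real. Qed.

Lemma bop_bounded f :
  exists2 M : R, 0 <= M & forall x, `|f x| <= M%:C * `|x|.
Proof.
have [_ [M fM]] := bounded_opP f.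
have M0 : (complex.Re `|M|)%:C = `|M| by rewrite RRe_real// ger0_real.
exists (complex.Re `|M|) => [|x]; first by rewrite -lecR M0 normr_ge0.
have Mx0 : 0 <= M * `|x| by exact: le_trans (fM x).
by rewrite M0 (le_trans (fM x))// -(ger0_norm Mx0) normrM normr_id.
Qed.

Lemma bop_comp_subproof f g : f \o g \in bounded_op_pred.
Proof.
apply/bounded_op_predP; split=> [a x y|]; first by rewrite /= !linearP.
have [M M0 fM] := bop_bounded f; have [N N0 gN] := bop_bounded g.
exists (M%:C * N%:C) => x; rewrite (le_trans (fM _))// -mulrA ler_wpM2l//.
by rewrite lecR.
Qed.

Definition bop_id : bounded_op H := BoundedOp bop_id_subproof.
Definition bop_comp f g : bounded_op H := BoundedOp (bop_comp_subproof f g).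

Lemma bop_compA : associative bop_comp.
Proof. by move=> f g h; apply: bop_eq. Qed.

Lemma bop_comp1l : left_id bop_id bop_comp.
Proof. by move=> f; apply: bop_eq. Qed.

Lemma bop_comp1r : right_id bop_id bop_comp.
Proof. by move=> f; apply: bop_eq. Qed.

Lemma bop_compDl : left_distributive bop_comp +%R.
Proof. by move=> f g h; apply: bop_eq. Qed.

Lemma bop_compDr : right_distributive bop_comp +%R.
Proof. by move=> f g h; apply: bop_eq => x; rewrite /= linearD. Qed.

HB.instance Definition _ := GRing.Zmodule_isPzRing.Build (bounded_op H)
  bop_compA bop_comp1l bop_comp1r bop_compDl bop_compDr.

Definition opnorm f : R :=
  sup [set complex.Re `|f x| | x in [set x : H | `|x| <= 1]].

Lemma opnorm_has_ubound f :
  has_ubound [set complex.Re `|f x| | x in [set x : H | `|x| <= 1]].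
Proof.
have [M M0 fM] := bop_bounded f; exists M => _ [x /= x1 <-].
rewrite -lecR -normr_ReE (le_trans (fM x))// -[leRHS]mulr1 ler_wpM2l// lecR.
exact: M0.
Qed.

Lemma opnorm_ge0 f : 0 <= opnorm f.
Proof.
apply: ub_le_sup; first exact: opnorm_has_ubound.
by exists 0 => /=; rewrite ?linear0 normr0.
Qed.

Lemma ler_opnorm f x : `|f x| <= (opnorm f)%:C * `|x|.
Proof.
have [->|x0] := eqVneq x 0; first by rewrite linear0 !normr0 mulr0.
have nx0 : 0 < `|x| by rewrite normr_gt0.
rewrite -ler_pdivrMr// mulrC.
have -> : `|x|^-1 * `|f x| = `|f (`|x|^-1 *: x)|.
  by rewrite linearZ normrZ ger0_norm// invr_ge0.
rewrite (normr_ReE (f _)) lecR; apply: ub_le_sup; first exact: opnorm_has_ubound.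
exists (`|x|^-1 *: x) => //=.
by rewrite normrZ ger0_norm ?invr_ge0// mulVf// gt_eqF.
Qed.

Lemma opnorm_le f (c : R) : 0 <= c -> (forall x, `|f x| <= c%:C * `|x|) ->
  opnorm f <= c.
Proof.
move=> c0 fc; apply: ge_sup.
  by exists (complex.Re `|f 0|); exists 0 => //=; rewrite normr0.
move=> _ [x /= x1 <-]; rewrite -lecR -normr_ReE (le_trans (fc x))//.
by rewrite -[leRHS]mulr1 ler_wpM2l// lecR.
Qed.

Lemma ler_opnormD f g : (opnorm (f + g))%:C <= (opnorm f)%:C + (opnorm g)%:C.
Proof.
rewrite -rmorphD lecR; apply: opnorm_le => [|x].
  by rewrite addr_ge0// opnorm_ge0.
rewrite bopD (le_trans (ler_normD _ _))// rmorphD mulrDl.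
by rewrite lerD// ler_opnorm.
Qed.

Lemma opnormZ (z : R[i]) f : (opnorm (z *: f))%:C = `|z| * (opnorm f)%:C.
Proof.
have le_opnormZ (w : R[i]) h : (opnorm (w *: h))%:C <= `|w| * (opnorm h)%:C.
  have wE : `|w| = (complex.Re `|w|)%:C by rewrite RRe_real// ger0_real.
  rewrite wE -rmorphM lecR; apply: opnorm_le => [|x].
    rewrite mulr_ge0 ?opnorm_ge0// -lecR -wE.
    exact: normr_ge0.
  rewrite rmorphM /= -wE normrZ -mulrA.
  by rewrite ler_wpM2l// ler_opnorm.
have [->|z0] := eqVneq z 0.
  rewrite scale0r normr0 mul0r; apply/eqP; rewrite eq_le.
  have := le_opnormZ 0 f; rewrite scale0r normr0 mul0r => ->/=.
  by rewrite lecR opnorm_ge0.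
apply/eqP; rewrite eq_le le_opnormZ/=.
have := le_opnormZ z^-1 (z *: f).
by rewrite scalerA mulVf// scale1r normfV mulrC ler_pdivlMr ?normr_gt0// mulrC.
Qed.

Lemma opnorm0_eq0 f : (opnorm f)%:C = 0 -> f = 0.
Proof.
move=> f0; apply: bop_eq => x; apply/eqP; rewrite -normr_le0.
by rewrite (le_trans (ler_opnorm f x))// f0 mul0r.
Qed.

HB.instance Definition _ := Lmodule_isNormed.Build R[i] (bounded_op H)
  ler_opnormD opnormZ opnorm0_eq0.

End BoundedOperatorAlgebra.

Record directedSet := DirectedSet {
  dir_index :> Type;
  dir_le : dir_index -> dir_index -> Prop;
  dir_inhabited : inhabited dir_index;
  dir_refl : forall s, dir_le s s;
  dir_trans : forall s t u, dir_le s t -> dir_le t u -> dir_le s u;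
  dir_upper : forall s t, exists u, dir_le s u /\ dir_le t u
}.

(* [e t @[t --> tails I] --> l] says that the net [e] indexed by [I] converges
   to [l]. *)
Definition tails (I : directedSet) : set_system I :=
  filter_from setT (fun s => [set t | dir_le s t]).
Arguments tails I : clear implicits.

#[global] Instance tails_filter (I : directedSet) : ProperFilter (tails I).
Proof.
apply: filter_from_proper; last by move=> s _; exists s; exact: dir_refl.
have [s0] := dir_inhabited I.
apply: filter_from_filter; first by exists s0.
move=> s t _ _; have [u [su tu]] := dir_upper s t.
by exists u => // v uv; split; [exact: dir_trans uv|exact: dir_trans uv].
Qed.

Section JordanOperatorAlgebras.
Context {R : realType} {H : hilbertType R}.
Implicit Types (A : set (bounded_op H)) (a b c u : bounded_op H) (z : R[i]).

Definition jprod a b : bounded_op H := 2^-1 *: (a * b + b * a).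

Definition jordan_operator_algebra A : Prop :=
  [/\ A 0,
      forall z a b, A a -> A b -> A (z *: a + b),
      closed A &
      forall a b, A a -> A b -> A (jprod a b)].

Definition is_jordan_unit A u : Prop :=
  A u /\ forall a, A a -> jprod u a = a.

Definition unital A : Prop := exists u, is_jordan_unit A u.

(* If [A] is unital, its unit need not be the identity operator of [H]. *)
Definition unitization A : set (bounded_op H) :=
  [set b | (unital A /\ A b) \/
           (~ unital A /\ exists a z, A a /\ b = a + z *: (1 : bounded_op H))].

Definition frakF A : set (bounded_op H) :=
  [set a | A a /\
           exists u, is_jordan_unit (unitization A) u /\ `|u - a| <= 1].

(* [j] realises [A] as a Jordan subalgebra of the C*-algebra [D]. Only the
   values of [j] on [A] matter. *)
Definition jordan_embedding A (D : cstarAlgType R) (j : bounded_op H -> D) :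
    Prop :=
  [/\ forall z a b, A a -> A b -> j (z *: a + b) = z *: j a + j b,
      forall a, A a -> `|j a| = `|a| &
      forall a b, A a -> A b ->
        j (jprod a b) = 2^-1 *: (cmul (j a) (j b) + cmul (j b) (j a))].

Definition partial_cai A (I : directedSet) (e : I -> bounded_op H) : Prop :=
  (forall t, A (e t) /\ `|e t| <= 1) /\
  forall (D : cstarAlgType R) (j : bounded_op H -> D), jordan_embedding A j ->
    forall a, A a ->
      cmul (j (e t)) (j a) @[t --> tails I] --> j a /\
      cmul (j a) (j (e t)) @[t --> tails I] --> j a.

Definition approximately_unital A : Prop :=
  exists (I : directedSet) (e : I -> bounded_op H), partial_cai A e.

End JordanOperatorAlgebras.

(* An action of [A] on [X] is a map defined on all of [bounded_op H], of which
   only the values at elements of [A] matter. *)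
Section JordanModules.
Context {R : realType} {H : hilbertType R} {X : completeNormedModType R[i]}.
Variable A : set (bounded_op H).
Implicit Types (a b c u : bounded_op H) (x : X).
Implicit Types (l : bounded_op H -> X -> X) (r : X -> bounded_op H -> X).

Definition left_premodule l : Prop :=
  [/\ forall a, A a -> linear (l a),
      forall (z : R[i]) a b x, A a -> A b ->
        l (z *: a + b) x = z *: l a x + l b x &
      forall a x, A a -> `|l a x| <= `|a| * `|x|].

Definition right_premodule r : Prop := left_premodule (fun a x => r x a).

Definition prebimodule l r : Prop :=
  [/\ left_premodule l, right_premodule r &
      forall a b x, A a -> A b -> l a (r x b) = r (l a x) b].

Definition left_nondegenerate l : Prop :=
  exists (I : directedSet) (e : I -> bounded_op H), partial_cai A e /\
    forall x, l (e t) x @[t --> tails I] --> x.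

Definition bi_nondegenerate l r : Prop :=
  exists (I : directedSet) (e : I -> bounded_op H), partial_cai A e /\
    forall x, l (e t) x @[t --> tails I] --> x /\
              r x (e t) @[t --> tails I] --> x.

(* For nonunital [A], every element of the unitization is [a + z *: 1] for a
   unique pair [(a, z)] with [a] in [A]. *)
Definition left_unital_ext l u x : X :=
  if `[< unital A >] then l u x
  else let p := xget (0, 0) [set p : bounded_op H * R[i] |
                             A p.1 /\ u = p.1 + p.2 *: (1 : bounded_op H)] in
       l p.1 x + p.2 *: x.

Definition right_unital_ext r x u : X :=
  left_unital_ext (fun a y => r y a) u x.

(* The factors [a1, ..., am] are the entries of the nonempty list [a :: s]. *)
Definition left_multiplicative (D : cstarAlgType R) (j : bounded_op H -> D) l :
    Prop :=
  forall a s c x, (forall b, b \in a :: s -> unitization A b) ->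
    unitization A c -> j c = foldl cmul (j a) [seq j b | b <- s] ->
    left_unital_ext l c x = foldr (left_unital_ext l) x (a :: s).

Definition right_multiplicative (D : cstarAlgType R) (j : bounded_op H -> D) r :
    Prop :=
  forall a s c x, (forall b, b \in a :: s -> unitization A b) ->
    unitization A c -> j c = foldl cmul (j a) [seq j b | b <- s] ->
    right_unital_ext r x c = foldl (right_unital_ext r) x (a :: s).

Definition nondegenerate_left_module l : Prop :=
  [/\ left_premodule l, left_nondegenerate l &
      exists (D : cstarAlgType R) (j : bounded_op H -> D),
        jordan_embedding (unitization A) j /\ left_multiplicative j l].

Definition nondegenerate_bimodule l r : Prop :=
  [/\ prebimodule l r, bi_nondegenerate l r &
      exists (D : cstarAlgType R) (j : bounded_op H -> D),
        [/\ jordan_embedding (unitization A) j,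
            left_multiplicative j l & right_multiplicative j r]].

End JordanModules.

(* Main.v *)
Require Import Defs.
From HB Require Import structures.
From mathcomp Require Import all_boot all_order all_algebra.
From mathcomp Require Import sesquilinear ring lra.
From mathcomp Require Import all_classical all_reals topology normedtype sequences.
From mathcomp Require Import complex.

Set Implicit Arguments.
Unset Strict Implicit.
Unset Printing Implicit Defensive.

Import Order.TTheory GRing.Theory Num.Theory.
Import numFieldNormedType.Exports.

Local Open Scope classical_set_scope.
Local Open Scope ring_scope.
Local Open Scope complex_scope.

(** The proof is Cohen's factorization argument, carried out with Jordan
    products. The unital case is immediate, with [a] a multiple of the unit. In
    the nonunital case let [(e t)] be the partial approximate identity. Elements
    [g n = scal (r n) + d n] of the unitization are constructed with [d n] in the
    algebra and [r n] tending to [0], each obtained from the preceding one by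
    replacing a quarter of the scalar [r n] by a multiple of a late [e t]
    ([cohen_step]). Each [g n] is invertible, and the solutions [x n] of
    [g n x = b] (of [g n x (g n) = b] for bimodules) converge: in
    [g n.+1 - g n = (r n / 4) (e t - 1)] the factor [e t - 1] is small on the
    given vectors when [t] is late. In the limit [a = lim (d n)] and
    [b0 = lim (x n)] factor [b] ([cohen_factorization]).

    Two things have to be under control before [t] is chosen: the norm of the
    inverse of [g n.+1], and the norm of [1 - g n], which has to stay at most [1]
    for [a] to satisfy [rnorm (1 - a) <= 1]. An approximate identity made of
    contractions only gives [rnorm (1 - e t) <= 2]. What helps is that a late
    [1 - e t] is almost orthogonal, from both sides, to the earlier [d n]. In
    [cai_norm_step] this shows that replacing part of the scalar affects the norm
    only as if [1 - g n] were a direct sum: it becomes, up to an arbitrarily small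
    error, at most the larger of [rnorm (1 - g n)] and [(1 - r n) + 2 * (r n / 4)].
    Both are smaller than [1], so [rnorm (1 - g n) < 1] is maintained by
    induction, and it also yields the inverse as a Neumann series
    ([unitization_inverse]). The norm estimate is [orthogonal_sum_norm]. It
    computes high powers of [T^* T] modulo the small mixed products
    ([orthogonal_powers]), so that the C*-identity turns a bound by the sum of
    three powers into one by their maximum. The products with adjoints are
    small because a contraction that almost fixes a vector has an adjoint that
    almost fixes it ([contraction_adjoint]).

    To use the approximate identity in these computations, bounded operators on
    [H] are made into a C*-algebra: adjoints come from the Riesz representation
    theorem ([riesz]), and completeness is [bop_complete].

    As [e t * c] need not belong to the algebra for [c] in the unitization, the
    sandwich [e t * c * e t], a Jordan polynomial, takes its place: it shows that
    the unitization acts contractively ([rnorm_ext]) and that the [x n] lie in the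
    closure of the required orbit. Associativity of the actions is needed
    there only for [a c a] and for mutually inverse elements, on which Jordan
    embeddings are multiplicative ([embed_triple], [embed_inverse]); as these
    look the same from the left and from the right, left modules and bimodules
    are treated together through [factorizing_action]. *)

(** * Real-valued norms *)

Section RealNorm.
Context {R : realType}.

(** Norms take values in [R[i]], whose order is partial; their real parts are
    elements of an ordered field, where linear arithmetic applies. *)
Definition rnorm (V : normedModType R[i]) (x : V) : R := complex.Re `|x|.

Section Theory.
Context {V : normedModType R[i]}.
Implicit Types x y z : V.

Lemma rnormE x : `|x| = (rnorm x)%:C.
Proof. exact: normr_ReE. Qed.

Lemma rnorm_ge0 x : 0 <= rnorm x.
Proof. by rewrite -lecR -rnormE; exact: normr_ge0. Qed.

Lemma rnorm0 : rnorm (0 : V) = 0.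
Proof. by rewrite /rnorm normr0. Qed.

Lemma rnorm0_eq0 x : rnorm x = 0 -> x = 0.
Proof. by move=> x0; apply/eqP; rewrite -normr_eq0 rnormE x0. Qed.

Lemma rnormD x y : rnorm (x + y) <= rnorm x + rnorm y.
Proof. by rewrite -lecR rmorphD /= -!rnormE ler_normD. Qed.

Lemma rnormN x : rnorm (- x) = rnorm x.
Proof. by rewrite /rnorm normrN. Qed.

Lemma rnormB x y : rnorm (x - y) <= rnorm x + rnorm y.
Proof. by rewrite -(rnormN y) rnormD. Qed.

Lemma rdistC x y : rnorm (x - y) = rnorm (y - x).
Proof. by rewrite -rnormN opprB. Qed.

Lemma rdistD z x y : rnorm (x - y) <= rnorm (x - z) + rnorm (z - y).
Proof. by rewrite -{1}(subrK z x) -addrA rnormD. Qed.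

Lemma Re_norm_ge0 (z : R[i]) : 0 <= complex.Re `|z|.
Proof. by have := normr_ge0 z; rewrite lecE => /andP[_]. Qed.

Lemma rnormZc (z : R[i]) x : rnorm (z *: x) = complex.Re `|z| * rnorm x.
Proof.
by rewrite /rnorm normrZ [`|x|]rnormE -[in LHS](@RRe_real _ `|z|) ?ger0_real//
  -rmorphM.
Qed.

Lemma rnormZ (r : R) x : rnorm (r%:C *: x) = `|r| * rnorm x.
Proof.
apply: (@complexI R); rewrite rmorphM /= -!rnormE normrZ.
by rewrite normc_def /= expr0n /= addr0 sqrtr_sqr.
Qed.

Lemma rnorm_cvgP T (F : set_system T) {FF : Filter F} (f : T -> V) l :
  f @ F --> l <->
  (forall eps : R, 0 < eps -> \forall t \near F, rnorm (l - f t) <= eps).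
Proof.
split=> [/cvgrPdist_le fl e e0|fl].
  have : \forall t \near F, `|l - f t| <= e%:C by apply: fl; rewrite ltcR.
  by apply: filterS => t; rewrite rnormE lecR.
apply/cvgrPdist_le => e e0.
have eE : e = (complex.Re e)%:C by rewrite RRe_real// gtr0_real.
have : \forall t \near F, rnorm (l - f t) <= complex.Re e.
  by apply: fl; rewrite -ltcR -eE.
by apply: filterS => t ft; rewrite rnormE eE lecR.
Qed.

Lemma rnorm_limit_le T (F : set_system T) {FF : ProperFilter F} (f : T -> V)
    l y (c : R) :
  f @ F --> l -> (\forall t \near F, rnorm (f t - y) <= c) -> rnorm (l - y) <= c.
Proof.
move=> /rnorm_cvgP fl fc; apply/ler_addgt0Pr => e e0.
have [t [flt ft]] := @filter_ex _ F _ _ (filterI (fl e e0) fc).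
rewrite (le_trans (rdistD (f t) _ _))//; lra.
Qed.

Lemma rnorm_closureP (S : set V) x :
  (forall eps : R, 0 < eps -> exists2 y, S y & rnorm (x - y) <= eps) ->
  closure S x.
Proof.
move=> Sx B /nbhs_ballP[e /= e0]; rewrite -ball_normE /= => eB.
have eE : e = (complex.Re e)%:C by rewrite RRe_real// gtr0_real.
have e20 : 0 < complex.Re e / 2.
  by rewrite divr_gt0// -ltcR -eE.
have [y Sy xy] := Sx _ e20.
exists y; split=> //; apply: eB => /=; rewrite rnormE eE ltcR.
lra.
Qed.

End Theory.

Lemma expr_small (q C eps : R) : 0 <= q -> q < 1 -> 0 < eps ->
  exists n, C * q ^+ n <= eps.
Proof.
move=> q0 q1 e0; have C1 : 0 < `|C| + 1 by rewrite ltr_wpDl.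
have : (fun n => q ^+ n) @ \oo --> 0 by apply: cvg_expr; rewrite ger0_norm.
move=> /cvgrPdist_le /(_ (eps / (`|C| + 1))) [|n _ /(_ n (leqnn _))].
  by rewrite divr_gt0.
rewrite sub0r normrN /= ger0_norm ?exprn_ge0// => qn.
exists n; rewrite (@le_trans _ _ ((`|C| + 1) * q ^+ n))//.
  by rewrite ler_wpM2r ?exprn_ge0// (le_trans (ler_norm C))// lerDl.
by rewrite mulrC -ler_pdivlMr.
Qed.

(** The rate of convergence is part of the conclusion, as the limits below have
    to be compared with given terms of their sequences. *)
Lemma geometric_cvg (V : completeNormedModType R[i]) (u : nat -> V) (C q : R) :
  0 <= C -> 0 <= q -> q < 1 ->
  (forall n, rnorm (u n.+1 - u n) <= C * q ^+ n) ->
  exists l, forall n, rnorm (l - u n) <= C / (1 - q) * q ^+ n.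
Proof.
move=> C0 q0 q1 uq.
have D0 : 0 <= C / (1 - q) by rewrite divr_ge0// subr_ge0 ltW.
have CD : C = C / (1 - q) * (1 - q) by rewrite divfK// subr_eq0 gt_eqF.
have uk n k : rnorm (u (n + k)%N - u n) <= C / (1 - q) * (q ^+ n - q ^+ (n + k)).
  elim: k => [|k IH]; first by rewrite addn0 !subrr mulr0 rnorm0.
  rewrite (le_trans (rdistD (u (n + k)%N) _ _))// addnS.
  rewrite (le_trans (lerD (uq _) IH))// {1}CD exprS.
  rewrite -mulrA -mulrDr ler_wpM2l//; lra.
have uk' n m : (n <= m)%N -> rnorm (u m - u n) <= C / (1 - q) * q ^+ n.
  move=> /subnKC <-; rewrite (le_trans (uk _ _))// ler_wpM2l//.
  by rewrite lerBlDr lerDl exprn_ge0.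
have : cvg (u @ \oo).
  apply/cauchy_cvgP/cauchy_exP => e e0.
  have eE : e = (complex.Re e)%:C by rewrite RRe_real// gtr0_real.
  have e20 : 0 < complex.Re e / 2 by rewrite divr_gt0// -ltcR -eE.
  have [n qn] := expr_small (C / (1 - q)) q0 q1 e20.
  exists (u n), n => // m /= nm; rewrite -ball_normE /= rnormE eE ltcR rdistC.
  by rewrite (le_lt_trans (uk' _ _ nm))//; lra.
move=> /cvg_ex[l ul]; exists l => n.
apply: (rnorm_limit_le ul); exists n => // m /=; exact: uk'.
Qed.

End RealNorm.

(** * Bounded operators form a C*-algebra *)

Section BoundedOperators.
Context {R : realType} {H : hilbertType R}.
Implicit Types (f g h : bounded_op H) (x y z : H).

Lemma rnorm_opnorm f : rnorm f = opnorm f.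
Proof. by []. Qed.

Lemma rnorm_bop f x : rnorm (f x) <= rnorm f * rnorm x.
Proof.
rewrite rnorm_opnorm -lecR rmorphM /= -!rnormE; exact: ler_opnorm.
Qed.

Lemma rnorm_bop_le f (c : R) : 0 <= c ->
  (forall x, rnorm (f x) <= c * rnorm x) -> rnorm f <= c.
Proof.
move=> c0 fc; rewrite rnorm_opnorm opnorm_le// => x.
by rewrite !rnormE -rmorphM lecR.
Qed.

Lemma rnorm_bopM f g : rnorm (f * g) <= rnorm f * rnorm g.
Proof.
apply: rnorm_bop_le => [|x]; first by rewrite mulr_ge0// rnorm_ge0.
rewrite (le_trans (rnorm_bop f (g x)))// -mulrA ler_wpM2l ?rnorm_ge0//.
exact: rnorm_bop.
Qed.

Lemma rnorm_bop1 : rnorm (1 : bounded_op H) <= 1.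
Proof. by apply: rnorm_bop_le => // x; rewrite mul1r. Qed.

Lemma bop_scalerAl (a : R[i]) f g : a *: (f * g) = (a *: f) * g.
Proof. exact: bop_eq. Qed.

Lemma bop_scalerAr (a : R[i]) f g : a *: (f * g) = f * (a *: g).
Proof.
apply: bop_eq => x; change (a *: f (g x) = f (a *: g x)).
by rewrite linearZ.
Qed.

(** The limit is built pointwise; it is bounded, and a limit in norm, because the
    rate of convergence at [x] is a fixed multiple of [rnorm x]. *)
Lemma bop_geometric_cvg (u : nat -> bounded_op H) (C : R) : 0 <= C ->
  (forall n, rnorm (u n.+1 - u n) <= C * 2^-1 ^+ n) ->
  exists l, forall n, rnorm (l - u n) <= C * 2 * 2^-1 ^+ n.
Proof.
move=> C0 uC.
have half0 : (0 : R) <= 2^-1 by rewrite invr_ge0.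
have half1 : (2^-1 : R) < 1 by lra.
have halfE : (1 - 2^-1 : R)^-1 = 2 by field.
have lim x : exists l, forall n,
    rnorm (l - u n x) <= C * 2 * 2^-1 ^+ n * rnorm x.
  have Cx0 : 0 <= C * rnorm x by rewrite mulr_ge0 ?rnorm_ge0.
  have [n|l lP] := @geometric_cvg _ _ (fun n => u n x) (C * rnorm x) 2^-1 Cx0 half0 half1.
    rewrite mulrAC (le_trans (rnorm_bop (u n.+1 - u n) x))//.
    by rewrite ler_wpM2r ?rnorm_ge0.
  exists l => n; rewrite (le_trans (lP n))// halfE.
  by rewrite -!mulrA ler_wpM2l// [leRHS]mulrA mulrC.
pose l x := projT1 (cid (lim x)).
have lP x n : rnorm (l x - u n x) <= C * 2 * 2^-1 ^+ n * rnorm x.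
  by rewrite /l; case: cid.
have l_lin : linear l.
  move=> a x y; apply/eqP; rewrite -subr_eq0; apply/eqP/rnorm0_eq0.
  apply/eqP; rewrite eq_le rnorm_ge0 andbT.
  apply/ler_addgt0Pr => e e0; rewrite add0r.
  pose B := rnorm (a *: x + y) + (complex.Re `|a| * rnorm x + rnorm y).
  have [n nB] := expr_small (C * 2 * B) half0 half1 e0.
  apply: le_trans nB.
  have -> : l (a *: x + y) - (a *: l x + l y) =
      (l (a *: x + y) - u n (a *: x + y)) -
      (a *: (l x - u n x) + (l y - u n y)).
    rewrite (linearP (u n)) scalerBr addrACA -opprD opprB.
    by rewrite addrA subrK.
  rewrite (le_trans (rnormB _ _))// /B mulrDr mulrDl lerD//.
    by rewrite mulrAC; exact: lP.
  rewrite (le_trans (rnormD _ _))// mulrDr mulrDl lerD//; last first.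
    by rewrite mulrAC; exact: lP.
  rewrite rnormZc; have a0 := Re_norm_ge0 a.
  rewrite (le_trans (ler_wpM2l a0 (lP x n)))//.
  by rewrite le_eqVlt; apply/orP; left; apply/eqP; ring.
have l_bd : exists M : R[i], forall x, `|l x| <= M * `|x|.
  exists (C * 2 + rnorm (u 0%N))%:C => x.
  rewrite !rnormE -rmorphM lecR mulrDl -(subrK (u 0%N x) (l x)).
  rewrite (le_trans (rnormD _ _))// lerD ?rnorm_bop//.
  by have := lP x 0%N; rewrite expr0 mulr1.
have lb : l \in bounded_op_pred by apply/bounded_op_predP.
exists (BoundedOp lb) => n; apply: rnorm_bop_le; last by move=> x; exact: lP.
by rewrite !mulr_ge0// exprn_ge0.
Qed.

(** A Cauchy filter contains balls of radius [2^-1 ^+ n]; consecutive ones meet,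
    so their centres form a geometric sequence. *)
Lemma bop_complete (F : set_system (bounded_op H)) : ProperFilter F ->
  cauchy F -> cvg F.
Proof.
move=> FF /cauchyP Fc.
have half1 : (2^-1 : R) < 1 by lra.
have cut n : exists f : bounded_op H, F [set g | rnorm (f - g) <= 2^-1 ^+ n].
  have [|f fF] := Fc ((2^-1 : R) ^+ n)%:C; first by rewrite ltcR exprn_gt0 ?invr_gt0.
  exists f; apply: filterS fF => g; rewrite -ball_normE /= rnormE ltcR.
  exact: ltW.
pose u n := projT1 (cid (cut n)).
have uP n : F [set g | rnorm (u n - g) <= 2^-1 ^+ n] by rewrite /u; case: cid.
have [//|n|l lP] := @bop_geometric_cvg u 2.
  have [g [g1 g2]] := @filter_ex _ F _ _ (filterI (uP n.+1) (uP n)).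
  rewrite (le_trans (rdistD g _ _))// (rdistC g).
  rewrite (le_trans (lerD g1 g2))// exprS.
  have : 0 <= (2^-1 : R) ^+ n by rewrite exprn_ge0 ?invr_ge0.
  lra.
apply/cvg_ex; exists l; apply/(@rnorm_cvgP _ _ _ F FF id) => e e0.
(* The filter is within [2^-1 ^+ n] of [u n], and [u n] within four times that
   of the limit. *)
have [n ne] := expr_small 5 (ltW (ltac:(by rewrite invr_gt0) : 0 < (2^-1 : R))) half1 e0.
apply: filterS (uP n) => g ug.
rewrite (le_trans (rdistD (u n) _ _))//.
rewrite (le_trans (lerD (lP n) ug))//.
apply: le_trans ne; lra.
Qed.

HB.instance Definition _ := Uniform_isComplete.Build (bounded_op H) bop_complete.

(** Its complex counterpart is recovered from it by [inner_rinner], and it keeps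
    every inequality in [R]. *)
Definition rinner x y : R := complex.Re (inner x y).

Lemma rinnerC x y : rinner x y = rinner y x.
Proof. by rewrite /rinner hermC /= expr0 mul1r; case: (inner y x). Qed.

Lemma rinnerDl x y z : rinner (x + y) z = rinner x z + rinner y z.
Proof. by rewrite /rinner linearDl raddfD. Qed.

Lemma rinnerNl x y : rinner (- x) y = - rinner x y.
Proof. by rewrite /rinner linearNl raddfN. Qed.

Lemma rinnerBl x y z : rinner (x - y) z = rinner x z - rinner y z.
Proof. by rewrite rinnerDl rinnerNl. Qed.

Lemma rinnerZl (r : R) x y : rinner (r%:C *: x) y = r * rinner x y.
Proof.
by rewrite /rinner linearZl /=; case: (inner x y) => a b /=; rewrite mul0r subr0.
Qed.

Lemma rinnerDr x y z : rinner x (y + z) = rinner x y + rinner x z.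
Proof. by rewrite !(rinnerC x) rinnerDl. Qed.

Lemma rinnerBr x y z : rinner x (y - z) = rinner x y - rinner x z.
Proof. by rewrite !(rinnerC x) rinnerBl. Qed.

Lemma rinnerZr (r : R) x y : rinner x (r%:C *: y) = r * rinner x y.
Proof. by rewrite !(rinnerC x) rinnerZl. Qed.

Lemma rinnerxx x : rinner x x = rnorm x ^+ 2.
Proof. by rewrite /rinner inner_norm rnormE -rmorphXn. Qed.

Lemma inner_rinner x y : inner x y = rinner x y +i* (- rinner ('i%C *: x) y).
Proof.
rewrite /rinner linearZl /=; case: (inner x y) => a b /=.
by rewrite mul0r mul1r sub0r opprK.
Qed.

Lemma rnorm_sqrD (t : R) x y : rnorm (x + t%:C *: y) ^+ 2 =
  rnorm x ^+ 2 + 2 * t * rinner x y + t ^+ 2 * rnorm y ^+ 2.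
Proof.
rewrite -!rinnerxx !(rinnerDl, rinnerDr, rinnerZl, rinnerZr) (rinnerC y x).
ring.
Qed.

(** The discriminant of a nonnegative quadratic polynomial in [t]. *)
Lemma quadratic_ge0 (al be ga : R) :
  (forall t : R, 0 <= t ^+ 2 * al + 2 * t * be + ga) -> 0 <= al ->
  be ^+ 2 <= al * ga.
Proof.
move=> pos al0; have ga0 : 0 <= ga by have := pos 0; lra.
have [al00|al1] := eqVneq al 0.
  have [->|be0] := eqVneq be 0; first by rewrite expr0n mulr_ge0.
  (* Without a quadratic term the polynomial takes the value [- 1] here. *)
  have := pos (- (ga + 1) / (2 * be)).
  have -> : 2 * (- (ga + 1) / (2 * be)) * be = - (ga + 1).
    by field.
  by rewrite al00 mulr0; lra.
have alp : 0 < al by rewrite lt_neqAle eq_sym al1.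
(* The minimum of the polynomial. *)
have := pos (- be / al).
have -> : (- be / al) ^+ 2 * al + 2 * (- be / al) * be + ga =
          (al * ga - be ^+ 2) / al by field.
by rewrite pmulr_lge0 ?invr_gt0// subr_ge0.
Qed.

Lemma rinner_CS x y : `|rinner x y| <= rnorm x * rnorm y.
Proof.
rewrite -ler_sqr ?nnegrE ?mulr_ge0 ?rnorm_ge0//.
rewrite real_normK ?num_real// exprMn mulrC.
apply: quadratic_ge0 => [t|]; last exact: sqr_ge0.
by have := sqr_ge0 (rnorm (x + t%:C *: y)); rewrite rnorm_sqrD; lra.
Qed.

(** Riesz: near-minimisers of [rnorm z ^+ 2 - 2 * psi z] nearly represent [psi],
    hence are close to each other, and their limit represents [psi]. *)
Lemma riesz (psi : H -> R) (C : R) :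
  (forall x y, psi (x + y) = psi x + psi y) ->
  (forall (r : R) x, psi (r%:C *: x) = r * psi x) ->
  (forall x, `|psi x| <= C * rnorm x) ->
  exists z, forall u, psi u = rinner z u.
Proof.
move=> psiD psiZ psiC.
pose J z := rnorm z ^+ 2 - 2 * psi z.
have lbJ : has_lbound (range J).
  exists (- C ^+ 2) => _ [z _ <-].
  have := psiC z; rewrite ler_norml => /andP[_ pC]; rewrite /J.
  have := sqr_ge0 (rnorm z - C); lra.
have infJ : has_inf (range J) by split=> //; exists (J 0), 0.
have near_rep (eta : R) : 0 < eta ->
    exists z, forall u, `|psi u - rinner z u| <= eta * rnorm u.
  move=> eta0; have eta20 : 0 < eta ^+ 2 by rewrite exprn_gt0.
  have [_ [z _ <-] Jz] := inf_adherent eta20 infJ.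
  exists z => u; rewrite -ler_sqr ?nnegrE ?mulr_ge0 ?rnorm_ge0 ?(ltW eta0)//.
  rewrite real_normK ?num_real// exprMn mulrC -sqrrN opprB.
  apply: quadratic_ge0 => [t|]; last exact: sqr_ge0.
  have : inf (range J) <= J (z + t%:C *: u).
    by apply: ge_inf => //; exists (z + t%:C *: u).
  move: Jz; rewrite /J rnorm_sqrD psiD psiZ; lra.
have half0 : (0 : R) < 2^-1 by rewrite invr_gt0.
have half1 : (2^-1 : R) < 1 by lra.
have rep n : exists z, forall u, `|psi u - rinner z u| <= 2^-1 ^+ n * rnorm u.
  by apply: near_rep; rewrite exprn_gt0 ?invr_gt0.
pose zs n := projT1 (cid (rep n)).
have zsP n u : `|psi u - rinner (zs n) u| <= 2^-1 ^+ n * rnorm u.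
  by rewrite /zs; case: cid.
have [//|n|z zP] := @geometric_cvg _ _ zs 2 2^-1 _ (ltW half0) half1.
  set d := zs n.+1 - zs n.
  have [d0|d0] := eqVneq (rnorm d) 0.
    by rewrite d0 mulr_ge0// exprn_ge0// ltW.
  have dp : 0 < rnorm d by rewrite lt_neqAle eq_sym d0 rnorm_ge0.
  rewrite -(ler_pM2r dp) -expr2 -rinnerxx {1}/d rinnerBl.
  have h0 := exprn_ge0 n (ltW half0).
  have := zsP n.+1 d; have := zsP n d; rewrite !ler_norml exprS.
  move=> /andP[? ?] /andP[? ?]; rewrite -mulrA.
  have : 0 <= 2^-1 ^+ n * rnorm d by rewrite mulr_ge0// ltW.
  lra.
exists z => u; apply/eqP; rewrite -subr_eq0 -normr_le0.
apply/ler_addgt0Pr => e e0; rewrite add0r.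
have [n ne] := expr_small (5 * rnorm u) (ltW half0) half1 e0.
apply: le_trans ne.
have -> : psi u - rinner z u =
    (psi u - rinner (zs n) u) - rinner (z - zs n) u by rewrite rinnerBl; ring.
rewrite (le_trans (ler_normB _ _))// (le_trans (lerD (zsP n u) (rinner_CS _ _)))//.
have := ler_wpM2r (rnorm_ge0 u) (zP n).
have -> : 2 / (1 - 2^-1) * 2^-1 ^+ n * rnorm u = 4 * (2^-1 ^+ n * rnorm u) :> R.
  by field.
lra.
Qed.

End BoundedOperators.

Section Adjoint.
Context {R : realType} {H : hilbertType R}.
Implicit Types (f g h : bounded_op H) (x y z : H).

Lemma innerC x y : inner x y = ((inner y x)^*)%C.
Proof. by rewrite hermC /= expr0 mul1r. Qed.

Lemma innerDl x y z : inner (x + y) z = inner x z + inner y z.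
Proof. exact: linearDl. Qed.

Lemma innerDr x y z : inner x (y + z) = inner x y + inner x z.
Proof. exact: linearDr. Qed.

Lemma innerZl (a : R[i]) x y : inner (a *: x) y = a * inner x y.
Proof. exact: linearZl_LR. Qed.

Lemma innerZr (a : R[i]) x y : inner x (a *: y) = (a^*)%C * inner x y.
Proof. exact: linearZr_LR. Qed.

Lemma inner_eq x y : (forall u, inner u x = inner u y) -> x = y.
Proof.
move=> xy; apply/eqP; rewrite -subr_eq0; apply/eqP/rnorm0_eq0/eqP.
by rewrite -sqrf_eq0 -rinnerxx rinnerBr /rinner xy subrr.
Qed.

Lemma adjoint_point f y : exists z, forall x, inner (f x) y = inner x z.
Proof.
have [|r x|x|z zP] := @riesz _ _ (fun u => rinner (f u) y) (rnorm f * rnorm y).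
- by move=> x x'; rewrite linearD rinnerDl.
- by rewrite linearZ rinnerZl.
- rewrite (le_trans (rinner_CS _ _))// mulrAC ler_wpM2r ?rnorm_ge0//.
  exact: rnorm_bop.
exists z => x; rewrite (inner_rinner (f x)) (inner_rinner x).
have -> : 'i%C *: f x = f ('i%C *: x) by rewrite linearZ.
by rewrite !zP !(rinnerC z).
Qed.

Definition adjoint_fun f y : H := projT1 (cid (adjoint_point f y)).

Lemma adjoint_funP f x y : inner (f x) y = inner x (adjoint_fun f y).
Proof. by rewrite /adjoint_fun; case: cid. Qed.

Lemma rnorm_adjoint_fun f y : rnorm (adjoint_fun f y) <= rnorm f * rnorm y.
Proof.
set z := adjoint_fun f y.
have [z0|z0] := eqVneq (rnorm z) 0.
  by rewrite z0 mulr_ge0 ?rnorm_ge0.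
have zp : 0 < rnorm z by rewrite lt_neqAle eq_sym z0 rnorm_ge0.
rewrite -(ler_pM2r zp) -expr2 -rinnerxx {2}/z /rinner -adjoint_funP.
rewrite (le_trans (ler_norm _))// (le_trans (rinner_CS _ _))//.
by rewrite mulrAC ler_wpM2r ?rnorm_ge0 ?rnorm_bop.
Qed.

Lemma adjoint_fun_bounded f : adjoint_fun f \in bounded_op_pred.
Proof.
apply/bounded_op_predP; split=> [a x y|].
  apply: inner_eq => u.
  by rewrite -adjoint_funP !(innerDr, innerZr) !adjoint_funP.
exists (rnorm f)%:C => x; rewrite !rnormE -rmorphM lecR.
exact: rnorm_adjoint_fun.
Qed.

Definition adjoint f : bounded_op H := BoundedOp (adjoint_fun_bounded f).

Lemma adjointP f x y : inner (f x) y = inner x (adjoint f y).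
Proof. exact: adjoint_funP. Qed.

Lemma adjoint_eq f g : (forall x y, inner (f x) y = inner x (g y)) ->
  adjoint f = g.
Proof.
by move=> fg; apply: bop_eq => y; apply: inner_eq => x; rewrite -adjointP.
Qed.

Lemma adjointK : involutive adjoint.
Proof.
by move=> f; apply: adjoint_eq => x y; rewrite innerC -adjointP -innerC.
Qed.

Lemma adjointD : {morph adjoint : f g / f + g}.
Proof.
move=> f g; apply: adjoint_eq => x y.
by rewrite !bopD innerDl innerDr !adjointP.
Qed.

Lemma adjointZ (a : R[i]) f : adjoint (a *: f) = (a^*)%C *: adjoint f.
Proof.
apply: adjoint_eq => x y.
by rewrite !bopZ innerZl innerZr conjcK adjointP.
Qed.

Lemma adjointM f g : adjoint (f * g) = adjoint g * adjoint f.
Proof.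
apply: adjoint_eq => x y.
by rewrite (adjointP f (g x)) adjointP.
Qed.

Lemma rnorm_adjoint_le f : rnorm (adjoint f) <= rnorm f.
Proof.
apply: rnorm_bop_le => [|x]; [exact: rnorm_ge0|exact: rnorm_adjoint_fun].
Qed.

Lemma rnorm_adjoint f : rnorm (adjoint f) = rnorm f.
Proof.
by apply/eqP; rewrite eq_le rnorm_adjoint_le -{1}(adjointK f) rnorm_adjoint_le.
Qed.

(** [rnorm (f x) ^+ 2 = <x, f^* f x>] gives the reverse inequality. *)
Lemma rnorm_adjointM f : rnorm (adjoint f * f) = rnorm f ^+ 2.
Proof.
apply/eqP; rewrite eq_le; apply/andP; split.
  by rewrite (le_trans (rnorm_bopM _ _))// rnorm_adjoint expr2.
rewrite -[leRHS]sqr_sqrtr ?rnorm_ge0// ler_sqr ?nnegrE ?rnorm_ge0 ?sqrtr_ge0//.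
apply: rnorm_bop_le => [|x]; first exact: sqrtr_ge0.
rewrite -ler_sqr ?nnegrE ?mulr_ge0 ?rnorm_ge0 ?sqrtr_ge0//.
rewrite exprMn sqr_sqrtr ?rnorm_ge0// -rinnerxx /rinner adjointP.
rewrite (le_trans (ler_norm _))// (le_trans (rinner_CS _ _))// mulrC expr2 mulrA.
by rewrite ler_wpM2r ?rnorm_ge0// (rnorm_bop (adjoint f * f)).
Qed.

Lemma normr_bopM f g : `|bop_comp f g| <= `|f| * `|g|.
Proof. by rewrite !rnormE -rmorphM lecR rnorm_bopM. Qed.

Lemma normr_adjointM f : `|bop_comp (adjoint f) f| = `|f| ^+ 2.
Proof. by rewrite !rnormE -rmorphXn rnorm_adjointM. Qed.

HB.instance Definition _ := isCstarAlgebra.Build R (bounded_op H)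
  (@bop_compA R H) (@bop_compDl R H) (@bop_compDr R H)
  (fun a f g => esym (bop_scalerAl a f g))
  (fun a f g => esym (bop_scalerAr a f g))
  normr_bopM adjointK adjointD adjointZ adjointM normr_adjointM.

End Adjoint.


(** * A norm estimate along an approximate identity *)

Section Vanishing.
Context {R : realType} {H : hilbertType R}.
Context {T : Type} {F : set_system T} {FF : ProperFilter F}.
Implicit Types (x y : T -> bounded_op H) (p : bounded_op H).

(** Convergence to [0], written out because the estimates below only ever
    produce and consume inequalities that hold eventually. *)
Definition vanishes x : Prop :=
  forall eps : R, 0 < eps -> \forall t \near F, rnorm (x t) <= eps.

Definition bounded_along x : Prop := exists B : R, forall t, rnorm (x t) <= B.

Lemma bounded_along_cst p : bounded_along (fun=> p).
Proof. by exists (rnorm p). Qed.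

Lemma bounded_alongD x y : bounded_along x -> bounded_along y ->
  bounded_along (fun t => x t + y t).
Proof.
move=> [B xB] [C yC]; exists (B + C) => t.
by rewrite (le_trans (rnormD _ _))// lerD.
Qed.

Lemma bounded_alongM x y : bounded_along x -> bounded_along y ->
  bounded_along (fun t => x t * y t).
Proof.
move=> [B xB] [C yC]; exists (B * C) => t.
by rewrite (le_trans (rnorm_bopM _ _))// ler_pM// rnorm_ge0.
Qed.

Lemma bounded_along_adjoint x : bounded_along x -> bounded_along (fun t => adjoint (x t)).
Proof. by move=> [B xB]; exists B => t; rewrite rnorm_adjoint. Qed.

Lemma vanishes_eq x y : vanishes x -> (forall t, x t = y t) -> vanishes y.
Proof. by move=> x0 xy e e0; apply: filterS (x0 e e0) => t; rewrite xy. Qed.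

Lemma vanishesD x y : vanishes x -> vanishes y -> vanishes (fun t => x t + y t).
Proof.
move=> x0 y0 e e0; have e20 : 0 < e / 2 by rewrite divr_gt0.
apply: filterS (filterI (x0 _ e20) (y0 _ e20)) => t [xe ye].
by rewrite (le_trans (rnormD _ _))//; lra.
Qed.

Lemma vanishesN x : vanishes x -> vanishes (fun t => - x t).
Proof. by move=> x0 e e0; apply: filterS (x0 e e0) => t; rewrite rnormN. Qed.

Lemma vanishes_adjoint x : vanishes x -> vanishes (fun t => adjoint (x t)).
Proof. by move=> x0 e e0; apply: filterS (x0 e e0) => t; rewrite rnorm_adjoint. Qed.

Lemma vanishesMl x y : bounded_along x -> vanishes y ->
  vanishes (fun t => x t * y t).
Proof.
move=> [B xB] y0 e e0; have B1 : 0 < `|B| + 1 by rewrite ltr_wpDl.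
have eB : 0 < e / (`|B| + 1) by rewrite divr_gt0.
apply: filterS (y0 _ eB) => t ye; rewrite (le_trans (rnorm_bopM _ _))//.
have -> : e = (`|B| + 1) * (e / (`|B| + 1)) by rewrite mulrC divfK// gt_eqF.
rewrite ler_pM ?rnorm_ge0// (le_trans (xB t))// (le_trans (ler_norm B))//.
by rewrite lerDl.
Qed.

Lemma vanishesMr x y : vanishes x -> bounded_along y ->
  vanishes (fun t => x t * y t).
Proof.
move=> x0 /bounded_along_adjoint yB.
have := vanishes_adjoint (vanishesMl yB (vanishes_adjoint x0)).
by move=> /vanishes_eq; apply=> t; rewrite adjointM !adjointK.
Qed.

Lemma vanishes_sqrt x y (c : R) : 0 <= c ->
  (forall t, rnorm (y t) ^+ 2 <= c * rnorm (x t)) -> vanishes x -> vanishes y.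
Proof.
move=> c0 yx x0 e e0; have c1 : 0 < c + 1 by rewrite ltr_wpDl.
have ec : 0 < e ^+ 2 / (c + 1) by rewrite divr_gt0// exprn_gt0.
apply: filterS (x0 _ ec) => t xe.
rewrite -ler_sqr ?nnegrE ?rnorm_ge0 ?(ltW e0)// (le_trans (yx t))//.
have -> : e ^+ 2 = (c + 1) * (e ^+ 2 / (c + 1)) by rewrite mulrC divfK// gt_eqF.
by rewrite ler_pM ?rnorm_ge0// lerDl.
Qed.

Definition scal (r : R) : bounded_op H := r%:C *: (1 : bounded_op H).

Lemma scal_mulC r p : scal r * p = p * scal r.
Proof. by rewrite /scal -bop_scalerAl -bop_scalerAr mul1r mulr1. Qed.

Lemma rnorm_scal r : 0 <= r -> rnorm (scal r) <= r.
Proof. by move=> r0; rewrite rnormZ ger0_norm// ler_piMr// rnorm_bop1. Qed.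

Lemma scalM r s : scal (r * s) = scal r * scal s.
Proof. by rewrite {2}/scal -bop_scalerAl mul1r scalerA -rmorphM. Qed.

Lemma adjoint1 : adjoint 1 = 1 :> bounded_op H.
Proof. exact: adjoint_eq. Qed.

Lemma adjoint_scal r : adjoint (scal r) = scal r.
Proof.
rewrite adjointZ adjoint1; congr (_ *: _); apply/eqP.
by rewrite eq_complex /= oppr0 !eqxx.
Qed.

(** The right-hand side has the shape of the left one before squaring, up to the
    products of [u] and [v]: a scalar, a term in [u] and a term in [v]. *)
Lemma sqr_sum3 (c u v : bounded_op H) : c * u = u * c -> c * v = v * c ->
  (c + u + v) * (c + u + v) =
  (c * c + (c + c + u) * u + (c + c + v) * v) + (u * v + v * u).
Proof.
move=> cu cv; rewrite !(mulrDl, mulrDr) -cu -cv !addrA.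
by rewrite [LHS](ACl (1*2*4*5*3*7*9*6*8)).
Qed.

(** Modulo vanishing terms the products [u * v t] and [v t * u] drop out of
    every power of [S t], so [S t ^+ n] is the sum of [(scal sg + u) ^+ n] and
    [(scal sg + v t) ^+ n] minus [scal sg ^+ n]. The factor [3] which this costs
    disappears after an [n]-th root. *)
Lemma orthogonal_powers k (S v : T -> bounded_op H) (u : bounded_op H)
    (sg nu : R) :
  0 <= sg <= nu -> rnorm (scal sg + u) <= nu ->
  (forall t, rnorm (scal sg + v t) <= nu) ->
  bounded_along S -> (forall t, adjoint (S t) = S t) ->
  vanishes (fun t => u * v t) -> vanishes (fun t => v t * u) ->
  vanishes (fun t => S t - (scal sg + u + v t)) ->
  forall eta : R, 0 < eta ->
  \forall t \near F, rnorm (S t) ^+ (2 ^ k) <= 3 * nu ^+ (2 ^ k) + eta.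
Proof.
elim: k S v u sg nu => [|k IH] S v u sg nu /andP[sg0 sgnu] unu vnu Sb Ssa uv vu SE.
  move=> eta eta0; apply: filterS (SE eta eta0) => t St.
  rewrite !expr1 -(subrK (scal sg + u + v t) (S t)).
  rewrite (le_trans (rnormD _ _))// addrC lerD//.
  have -> : scal sg + u + v t = (scal sg + u) + (scal sg + v t) - scal sg.
    by rewrite addrA (addrAC _ (v t)) addrK addrAC.
  have := rnormB ((scal sg + u) + (scal sg + v t)) (scal sg).
  have := rnormD (scal sg + u) (scal sg + v t).
  have := rnorm_scal sg0; have := vnu t; lra.
move=> eta eta0; have nu0 : 0 <= nu by exact: le_trans sgnu.
pose c := scal sg; have cC p : c * p = p * c by exact: scal_mulC.
have vb : bounded_along v.
  exists (nu + rnorm c) => t; rewrite -(addKr c (v t)) addrC.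
  by rewrite (le_trans (rnormB _ _))// lerD2r vnu.
have c2b : bounded_along (fun t => c + c + v t).
  by apply: bounded_alongD => //; exact: bounded_along_cst.
have sqE p : c * c + (c + c + p) * p = (c + p) * (c + p).
  by rewrite !(mulrDl, mulrDr) -(cC p) -!addrA.
have := IH (fun t => S t * S t) (fun t => (c + c + v t) * v t)
  ((c + c + u) * u) (sg * sg) (nu * nu); rewrite scalM -/c => {}IH.
have : \forall t \near F,
    rnorm (S t * S t) ^+ (2 ^ k) <= 3 * (nu * nu) ^+ (2 ^ k) + eta.
  apply: IH => //.
  - by rewrite mulr_ge0//= ler_pM.
  - by rewrite sqE (le_trans (rnorm_bopM _ _))// ler_pM ?rnorm_ge0.
  - by move=> t; rewrite sqE (le_trans (rnorm_bopM _ _))// ler_pM ?rnorm_ge0.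
  - exact: bounded_alongM.
  - by move=> t; rewrite adjointM Ssa.
  - have uv' := vanishesMl (bounded_along_cst (c + c + u)) (vanishesMr uv c2b).
    apply: (vanishes_eq uv') => t.
    have -> : (c + c + v t) * v t = v t * (c + c + v t).
      by rewrite mulrDl mulrDr; congr (_ + _); rewrite mulrDl mulrDr cC.
    by rewrite !mulrA.
  - have vu' := vanishesMr (vanishesMl c2b vu) (bounded_along_cst (c + c + u)).
    apply: (vanishes_eq vu') => t.
    have -> : (c + c + u) * u = u * (c + c + u).
      by rewrite mulrDl mulrDr; congr (_ + _); rewrite mulrDl mulrDr cC.
    by rewrite !mulrA.
  - have Mb : bounded_along (fun t => c + u + v t).
      by apply: bounded_alongD => //; exact: bounded_along_cst.
    have SS := vanishesD (vanishesMl Sb SE) (vanishesMr SE Mb).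
    apply: (vanishes_eq (vanishesD SS (vanishesD uv vu))) => t.
    rewrite mulrBr mulrBl -/c subrKA sqr_sum3//.
    move: (u * v t + v t * u) => w.
    by rewrite opprD addrA subrK.
apply: filterS => t.
have -> : rnorm (S t * S t) = rnorm (S t) ^+ 2.
  by rewrite -{1}(Ssa t) rnorm_adjointM.
by rewrite -!expr2 -!exprM -expnS.
Qed.

(** A contraction which nearly fixes a vector has an adjoint which nearly fixes
    it too: [rnorm (e^* z - z) ^+ 2 <= 2 * <z, z - e z>]. *)
Lemma contraction_adjoint (e d : bounded_op H) : rnorm e <= 1 ->
  rnorm (d - adjoint e * d) ^+ 2 <= 2 * rnorm d * rnorm (d - e * d).
Proof.
move=> e1; set c := 2 * rnorm d * _.
have c0 : 0 <= c by rewrite !mulr_ge0 ?rnorm_ge0.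
rewrite -[leRHS]sqr_sqrtr// ler_sqr ?nnegrE ?rnorm_ge0 ?sqrtr_ge0//.
apply: rnorm_bop_le => [|x]; first exact: sqrtr_ge0.
rewrite -ler_sqr ?nnegrE ?mulr_ge0 ?rnorm_ge0 ?sqrtr_ge0//.
rewrite exprMn sqr_sqrtr//; pose z := d x.
have -> : (d - adjoint e * d) x = z - adjoint e z by [].
have ez : rnorm (adjoint e z) ^+ 2 <= rnorm z ^+ 2.
  rewrite ler_sqr ?nnegrE ?rnorm_ge0// (le_trans (rnorm_bop _ _))//.
  by rewrite rnorm_adjoint ler_piMl ?rnorm_ge0.
have zz : rinner z (adjoint e z) = rinner z (e z).
  by rewrite (rinnerC z (e z)) /rinner adjointP.
rewrite -rinnerxx !rinnerBl !rinnerBr (rinnerC (adjoint e z) z) zz !rinnerxx.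
have -> : c = 2 * (rnorm d * rnorm (d - e * d)) by rewrite mulrA.
have : rinner z (z - e z) <= rnorm d * rnorm (d - e * d) * rnorm x ^+ 2.
  rewrite (le_trans (ler_norm _))// (le_trans (rinner_CS _ _))//.
  rewrite expr2 mulrACA ler_pM ?rnorm_ge0 ?rnorm_bop//.
  exact: (rnorm_bop (d - e * d)).
rewrite rinnerBr rinnerxx; lra.
Qed.

(** The [2 ^ k]-th roots of the bounds of [orthogonal_powers] for [X^* X], with
    [X = scal s + p + q t], approach [N ^+ 2]; so the norm behaves as for a direct
    sum of [scal s + p] and [scal s + q t]. *)
Lemma orthogonal_sum_norm (s N M : R) (p : bounded_op H)
    (q : T -> bounded_op H) :
  0 <= s <= N -> 0 < N -> N < M -> rnorm (scal s + p) <= N ->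
  (forall t, rnorm (scal s + q t) <= N) ->
  vanishes (fun t => p * q t) -> vanishes (fun t => p * adjoint (q t)) ->
  vanishes (fun t => adjoint p * q t) ->
  vanishes (fun t => adjoint p * adjoint (q t)) ->
  \forall t \near F, rnorm (scal s + p + q t) <= M.
Proof.
move=> /andP[s0 sN] N0 NM pN qN pq pq' p'q p'q'.
have M0 : 0 < M by exact: lt_trans NM.
pose c := scal s; have cC r : c * r = r * c by exact: scal_mulC.
have cA : adjoint c = c by exact: adjoint_scal.
have qb : bounded_along q.
  exists (N + rnorm c) => t; rewrite -(addKr c (q t)) addrC.
  by rewrite (le_trans (rnormB _ _))// lerD2r qN.
have qb' := bounded_along_adjoint qb.
pose A := c + p; pose B t := c + q t; pose X t := c + p + q t.
have Ab : bounded_along (fun=> A) by exact: bounded_along_cst.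
have Bb : bounded_along B by apply: bounded_alongD => //; exact: bounded_along_cst.
have Xb : bounded_along X by apply: bounded_alongD.
have qp : vanishes (fun t => q t * p).
  apply: (vanishes_eq (vanishes_adjoint p'q')) => t.
  by rewrite adjointM !adjointK.
have q'p : vanishes (fun t => adjoint (q t) * p).
  apply: (vanishes_eq (vanishes_adjoint p'q)) => t.
  by rewrite adjointM adjointK.
have qp' : vanishes (fun t => q t * adjoint p).
  apply: (vanishes_eq (vanishes_adjoint pq')) => t.
  by rewrite adjointM adjointK.
have q'p' : vanishes (fun t => adjoint (q t) * adjoint p).
  by apply: (vanishes_eq (vanishes_adjoint pq)) => t; rewrite adjointM.
(* [S = adjoint X * X] is, up to vanishing products of [p] and [q], the sum of
   [scal (s ^+ 2)] with a part [u] that involves only [p] and a part [v] that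
   involves only [q]. Each part is written with the factors [p] on the right
   and, as [u2] and [v2], on the left, to expose them in [u * v] and [v * u]. *)
pose u := adjoint A * p + c * adjoint p.
pose u2 := adjoint p * A + c * p.
pose v t := adjoint (B t) * q t + c * adjoint (q t).
pose v2 t := adjoint (q t) * B t + c * q t.
have u2E : u = u2.
  rewrite /u /u2 /A adjointD cA mulrDl mulrDr -(cC (adjoint p)).
  by rewrite [LHS](ACl (3*2*1)).
have v2E t : v t = v2 t.
  rewrite /v /v2 /B adjointD cA mulrDl mulrDr -(cC (adjoint (q t))).
  by rewrite [LHS](ACl (3*2*1)).
have csq : scal (s ^+ 2) = c * c by rewrite expr2 scalM.
have uE : scal (s ^+ 2) + u = adjoint A * A.
  rewrite csq {2}/A mulrDr /u addrCA addrC; congr (_ + _).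
  by rewrite /A adjointD cA mulrDl (cC (adjoint p)).
have vE t : scal (s ^+ 2) + v t = adjoint (B t) * B t.
  rewrite csq {2}/B mulrDr /v addrCA addrC; congr (_ + _).
  by rewrite /B adjointD cA mulrDl (cC (adjoint (q t))).
have cb : bounded_along (fun=> c) by exact: bounded_along_cst.
have uv : vanishes (fun t => u * v t).
  have lv : vanishes (fun t => p * v t).
    apply: vanishes_eq (vanishesD (vanishesMr pq' Bb) (vanishesMr pq cb)) _ => t.
    by rewrite v2E /v2 (cC (q t)) [RHS]mulrDr !mulrA.
  have lv' : vanishes (fun t => adjoint p * v t).
    apply: vanishes_eq (vanishesD (vanishesMr p'q' Bb) (vanishesMr p'q cb)) _ => t.
    by rewrite v2E /v2 (cC (q t)) [RHS]mulrDr !mulrA.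
  have A'b : bounded_along (fun=> adjoint A) by exact: bounded_along_cst.
  apply: vanishes_eq (vanishesD (vanishesMl A'b lv) (vanishesMl cb lv')) _ => t.
  by rewrite /u [RHS]mulrDl !mulrA.
have vu : vanishes (fun t => v t * u).
  have lu : vanishes (fun t => q t * u).
    apply: vanishes_eq (vanishesD (vanishesMr qp' Ab) (vanishesMr qp cb)) _ => t.
    by rewrite u2E /u2 (cC p) [RHS]mulrDr !mulrA.
  have lu' : vanishes (fun t => adjoint (q t) * u).
    apply: vanishes_eq (vanishesD (vanishesMr q'p' Ab) (vanishesMr q'p cb)) _ => t.
    by rewrite u2E /u2 (cC p) [RHS]mulrDr !mulrA.
  have B'b := bounded_along_adjoint Bb.
  apply: vanishes_eq (vanishesD (vanishesMl B'b lu) (vanishesMl cb lu')) _ => t.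
  by rewrite /v [RHS]mulrDl !mulrA.
pose S t := adjoint (X t) * X t.
have SE : vanishes (fun t => S t - (scal (s ^+ 2) + u + v t)).
  apply: vanishes_eq (vanishesD p'q q'p) _ => t.
  rewrite uE /S; have -> : X t = A + q t by [].
  have -> : v t = adjoint A * q t + adjoint (q t) * A + adjoint (q t) * q t
      - (adjoint p * q t + adjoint (q t) * p).
    rewrite /v /A /B !adjointD cA !(mulrDl, mulrDr).
    rewrite (cC (q t)) (cC (adjoint (q t))) opprD !addrA.
    by rewrite [RHS](ACl (1*5*3*2*6*4*7))/= !addrK.
  rewrite adjointD.
  suff expand (w a' a b' b : bounded_op H) : w =
      (a' + b') * (a + b) - (a' * a + (a' * b + b' * a + b' * b - w)).
    exact: expand.
  rewrite !(mulrDl, mulrDr) !addrA.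
  by rewrite opprB addrCA subrr addr0.
(* Since [N < M], a high power absorbs the factor [3]. *)
have [k Mk] : exists k, 3 * N ^+ (2 ^ k.+1) <= M ^+ (2 ^ k.+1) / 2.
  have r0 : 0 <= N / M by rewrite divr_ge0// ltW.
  have r1 : N / M < 1 by rewrite ltr_pdivrMr// mul1r.
  have e0 : (0 : R) < 2^-1 by rewrite invr_gt0.
  have [n nr] := expr_small 3 r0 r1 e0; exists n.
  have nn : (n <= 2 ^ n.+1)%N.
    by rewrite (leq_trans (ltnW (ltn_expl n (ltnSn 1))))// leq_exp2l.
  have : 3 * (N / M) ^+ (2 ^ n.+1) <= 2^-1.
    rewrite (le_trans _ nr)// ler_pM2l// ler_wiXn2l//; exact: ltW.
  rewrite expr_div_n mulrA ler_pdivrMr ?exprn_gt0//; lra.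
have eta0 : 0 < M ^+ (2 ^ k.+1) / 2 by rewrite divr_gt0// exprn_gt0.
have : \forall t \near F,
   rnorm (S t) ^+ (2 ^ k) <= 3 * (N ^+ 2) ^+ (2 ^ k) + M ^+ (2 ^ k.+1) / 2.
  apply: orthogonal_powers uv vu SE _ eta0.
  - by rewrite sqr_ge0 ler_sqr ?nnegrE ?(ltW N0).
  - rewrite uE rnorm_adjointM ler_sqr ?nnegrE ?rnorm_ge0 ?(ltW N0)//; exact: pN.
  - move=> t; rewrite vE rnorm_adjointM ler_sqr ?nnegrE ?rnorm_ge0 ?(ltW N0)//.
    exact: qN.
  - by apply: bounded_alongM => //; exact: bounded_along_adjoint.
  - by move=> t; rewrite adjointM adjointK.
apply: filterS => t.
rewrite rnorm_adjointM -!exprM -expnS => XM.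
have := le_trans XM (lerD Mk (lexx _)); rewrite -splitr.
by rewrite ler_pXn2r ?nnegrE ?rnorm_ge0 ?(ltW M0)// expn_gt0.
Qed.

End Vanishing.

(** * Jordan identities *)

Section JordanIdentities.
Context {R : realType} {D : cstarAlgType R}.
Implicit Types x y u : D.

(** [jprod] in an arbitrary C*-algebra. *)
Definition jordan x y : D := 2^-1 *: (cmul x y + cmul y x).

Lemma scale2 x : (2 : R[i]) *: x = x + x.
Proof. by rewrite scaler_nat. Qed.

Lemma half_double x : (2 : R[i])^-1 *: (x + x) = x.
Proof. by rewrite -scale2 scalerA mulVf ?scale1r// pnatr_eq0. Qed.

Lemma double_inj x y : x + x = y + y -> x = y.
Proof. by move=> xy; rewrite -[x]half_double xy half_double. Qed.

Lemma cmul_jordanxx x : jordan x x = cmul x x.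
Proof. exact: half_double. Qed.

(** Jordan homomorphisms preserve [x y x] because it can be expressed by Jordan
    products alone. *)
Lemma cmul_triple x y :
  cmul (cmul x y) x = 2 *: jordan (jordan x y) x - jordan (jordan x x) y.
Proof.
rewrite cmul_jordanxx /jordan scalerA divff ?pnatr_eq0// scale1r.
rewrite cmulZl cmulZr -scalerDr cmulDl cmulDr -scalerBr !cmulA.
apply: (@scalerI _ _ (2 : R[i])); first by rewrite pnatr_eq0.
rewrite scalerA divff ?pnatr_eq0// scale1r scale2 opprD !addrA.
by rewrite [RHS](ACl (1*4*3*5*2*6))/= !addrK.
Qed.

(** Multiplying [u a + a u = 2 a] by [u] on either side gives [u a = u a u] and
    [a u = u a u]. *)
Lemma jordan_unit_cmul u x : jordan u u = u -> jordan u x = x ->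
  cmul u x = x /\ cmul x u = x.
Proof.
rewrite cmul_jordanxx => uu ux.
have ux2 : cmul u x + cmul x u = x + x.
  by rewrite -[in RHS]ux /jordan -scale2 scalerA divff ?pnatr_eq0// scale1r.
have e1 : cmul (cmul u x) u = cmul u x.
  have := congr1 (cmul u) ux2; rewrite !cmulDr !cmulA uu => /addrI.
  exact.
have e2 : cmul (cmul u x) u = cmul x u.
  have := congr1 (cmul^~ u) ux2; rewrite !cmulDl -cmulA -(cmulA x u u) uu.
  by rewrite cmulA => /addIr.
have e3 : cmul u x = cmul x u by rewrite -e1.
split; apply: double_inj; rewrite -ux2 -e3//.
Qed.

(** [x y] and [y x] are idempotents with sum [2 u], and [u] is a unit for both;
    multiplying the sum by either shows that they agree. *)
Lemma jordan_inverse_cmul u x y :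
  cmul u x = x -> cmul u y = y -> cmul x u = x ->
  jordan x y = u -> cmul (cmul x y) x = x -> cmul (cmul y x) y = y ->
  cmul x y = u.
Proof.
move=> ux uy xu xyu xyx yxy.
have pq2 : cmul x y + cmul y x = u + u.
  by rewrite -xyu /jordan -scale2 scalerA divff ?pnatr_eq0// scale1r.
have pp : cmul (cmul x y) (cmul x y) = cmul x y by rewrite cmulA xyx.
have qq : cmul (cmul y x) (cmul y x) = cmul y x by rewrite cmulA yxy.
have qp1 : cmul (cmul y x) (cmul x y) = cmul x y.
  have := congr1 (cmul^~ (cmul x y)) pq2; rewrite !cmulDl pp (cmulA u x y) ux.
  exact: addrI.
have qp2 : cmul (cmul y x) (cmul x y) = cmul y x.
  have := congr1 (cmul (cmul y x)) pq2; rewrite !cmulDr qq -(cmulA y x u) xu.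
  exact: addIr.
by apply: double_inj; rewrite -pq2 -{2}qp1 qp2.
Qed.

End JordanIdentities.

Section JordanAlgebra.
Context {R : realType} {H : hilbertType R}.
Variables (A : set (bounded_op H)) (AJ : jordan_operator_algebra A).
Implicit Types (a b c d e g u : bounded_op H) (z : R[i]).

Lemma jalg0 : A 0. Proof. by case: AJ. Qed.

Lemma jalgZD z a b : A a -> A b -> A (z *: a + b).
Proof. by case: AJ => _ + _ _; apply. Qed.

Lemma jalg_closed : closed A. Proof. by case: AJ. Qed.

Lemma jalg_jprod a b : A a -> A b -> A (jprod a b).
Proof. by case: AJ => _ _ _; apply. Qed.

Lemma jalgZ z a : A a -> A (z *: a).
Proof. by move=> Aa; rewrite -[_ *: _]addr0; apply: jalgZD => //; exact: jalg0. Qed.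

Lemma jalgD a b : A a -> A b -> A (a + b).
Proof. by move=> Aa Ab; rewrite -[a]scale1r; exact: jalgZD. Qed.

Lemma jalgB a b : A a -> A b -> A (a - b).
Proof. by move=> Aa Ab; rewrite addrC -scaleN1r; exact: jalgZD. Qed.

Lemma jprod_tripleE a b : a * b * a = 2 *: jprod (jprod a b) a - jprod (jprod a a) b.
Proof. exact: (cmul_triple (a : bounded_op H) b). Qed.

Lemma jprodxx a : jprod a a = a * a.
Proof. exact: (half_double (a * a)). Qed.

Lemma jprod_comm a b : a * b = b * a -> jprod a b = a * b.
Proof. by move=> ab; rewrite /jprod -ab; exact: half_double. Qed.

Lemma jalg_triple a b : A a -> A b -> A (a * b * a).
Proof.
move=> Aa Ab; rewrite jprod_tripleE; apply: jalgB; last first.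
  by apply: jalg_jprod => //; exact: jalg_jprod.
by apply: jalgZ; apply: jalg_jprod => //; exact: jalg_jprod.
Qed.

Lemma jordan_unit_mul u a : is_jordan_unit A u -> A a -> u * a = a /\ a * u = a.
Proof. by move=> [Au uA] Aa; apply: (@jordan_unit_cmul _ _ u a); exact: uA. Qed.

Section ApproximateIdentity.
Variables (I : directedSet) (e : I -> bounded_op H) (e_cai : partial_cai A e).

Lemma cai_mem t : A (e t). Proof. by case: e_cai => + _ => /(_ t)[]. Qed.

Lemma cai_rnorm t : rnorm (e t) <= 1.
Proof. by case: e_cai => + _ => /(_ t)[_]; rewrite rnormE lecR. Qed.

(** The C*-algebra in which the approximate identity is used is that of all
    bounded operators on [H], where adjoints act on vectors. *)
Lemma cai_mull a : A a -> vanishes (F := tails I) (fun t => a - e t * a).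
Proof.
have [_ /(_ (bounded_op H) id) cai] := e_cai.
by move=> /(cai _)[] // /rnorm_cvgP.
Qed.

Lemma cai_mulr a : A a -> vanishes (F := tails I) (fun t => a - a * e t).
Proof.
have [_ /(_ (bounded_op H) id) cai] := e_cai.
by move=> /(cai _)[] // _ /rnorm_cvgP.
Qed.

(** Late terms of the approximate identity make [1 - e t] almost orthogonal to
    [d], and to its adjoint because [e t] is a contraction. *)
Lemma cai_norm_step (s w N M : R) d : A d -> 0 <= s -> 0 < w ->
  s + 2 * w <= N -> N < M -> rnorm (scal s - d) <= N ->
  \forall t \near tails I, rnorm (scal s - d + w%:C *: (1 - e t)) <= M.
Proof.
move=> Ad s0 w0 swN NM dN.
have r := cai_mulr Ad; have l := cai_mull Ad.
have la : vanishes (F := tails I) (fun t => d - adjoint (e t) * d).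
  apply: (vanishes_sqrt _ _ l) => [|t]; last exact/contraction_adjoint/cai_rnorm.
  by rewrite mulr_ge0 ?rnorm_ge0.
have adjB a b : adjoint (a - b) = adjoint a - adjoint b.
  by rewrite adjointD -scaleN1r adjointZ rmorphN1 scaleN1r.
have ra : vanishes (F := tails I) (fun t => adjoint d - e t * adjoint d).
  apply: (vanishes_sqrt _ _ (vanishes_adjoint r)) => [|t].
    by apply: (mulr_ge0 _ (rnorm_ge0 (adjoint d))); exact: (ler0n _ 2).
  have := @contraction_adjoint _ _ (adjoint (e t)) (adjoint d).
  by rewrite adjointK rnorm_adjoint adjB adjointM => /(_ (cai_rnorm t)).
have wa b : adjoint (w%:C *: b) = w%:C *: adjoint b.
  by rewrite adjointZ; congr (_ *: _); apply/eqP; rewrite eq_complex /= oppr0 !eqxx.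
have vZ (x : I -> bounded_op H) : vanishes (F := tails I) x ->
    vanishes (F := tails I) (fun t => - (w%:C *: x t)).
  move=> x0; apply: vanishesN.
  have wx : vanishes (F := tails I) (fun t => scal w * x t).
    exact: (vanishesMl (bounded_along_cst (scal w)) x0).
  apply: (vanishes_eq wx) => t.
  by rewrite /scal -bop_scalerAl mul1r.
have pw p b : (- p) * (w%:C *: b) = - (w%:C *: (p * b)).
  by rewrite -bop_scalerAr mulNr scalerN.
have adjN : adjoint (- d) = - adjoint d.
  by rewrite -scaleN1r adjointZ rmorphN1 scaleN1r.
apply: (@orthogonal_sum_norm _ _ _ _ _ s N M (- d)) => //.
- by rewrite s0; lra.
- by lra.
- move=> t; rewrite (le_trans (rnormD _ _))// (le_trans _ swN)// lerD ?rnorm_scal//.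
  rewrite rnormZ gtr0_norm// mulrC ler_wpM2r ?(ltW w0)//.
  rewrite (le_trans (rnormB _ _))//.
  by rewrite (le_trans (lerD (rnorm_bop1 (H := H)) (cai_rnorm t))).
- by apply: vanishes_eq (vZ _ r) _ => t; rewrite pw mulrBr mulr1.
- apply: vanishes_eq (vZ _ (vanishes_adjoint ra)) _ => t.
  by rewrite wa pw !adjB adjoint1 adjointM adjointK mulrBr mulr1.
- apply: vanishes_eq (vZ _ (vanishes_adjoint la)) _ => t.
  by rewrite adjN pw adjB adjointM adjointK mulrBr mulr1.
- apply: vanishes_eq (vZ _ (vanishes_adjoint l)) _ => t.
  by rewrite adjN wa pw !adjB adjoint1 adjointM mulrBr mulr1.
Qed.

End ApproximateIdentity.

End JordanAlgebra.

(** * The unitization of a nonunital algebra and its actions *)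

Section Unitization.
Context {R : realType} {H : hilbertType R}.
Variables (A : set (bounded_op H)) (AJ : jordan_operator_algebra A).
Hypothesis A_nonunital : ~ unital A.
Implicit Types (a b c d e g u : bounded_op H) (z : R[i]).

Local Notation U := (unitization A).

Lemma unitizationP c : U c <-> exists a z, A a /\ c = a + z *: (1 : bounded_op H).
Proof. by split=> [[[]|[]]|cE]//; right. Qed.

Lemma sub_unitization a : A a -> U a.
Proof. by move=> Aa; apply/unitizationP; exists a, 0; rewrite scale0r addr0. Qed.

Lemma unitization_scal r : U (scal r).
Proof. by apply/unitizationP; exists 0, r%:C; rewrite add0r; split=> //; exact: jalg0. Qed.

Lemma unitization1 : U 1.
Proof.
apply/unitizationP; exists 0, 1; rewrite add0r scale1r; split=> //.
exact: jalg0.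
Qed.

Lemma unitizationZD z b c : U b -> U c -> U (z *: b + c).
Proof.
move=> /unitizationP[a [x [Aa ->]]] /unitizationP[a' [x' [Aa' ->]]].
apply/unitizationP; exists (z *: a + a'), (z * x + x'); split.
  exact: jalgZD.
by rewrite scalerDr scalerA scalerDl addrACA.
Qed.

Lemma unitizationD b c : U b -> U c -> U (b + c).
Proof. by rewrite -{2}[b]scale1r; exact: unitizationZD. Qed.

Lemma unitizationB b c : U b -> U c -> U (b - c).
Proof. by move=> Ub Uc; rewrite addrC -scaleN1r; exact: unitizationZD. Qed.

Lemma jprod1 a : jprod 1 a = a.
Proof. by rewrite jprod_comm ?mulr1 ?mul1r. Qed.

Lemma unitizationZ z a : U a -> U (z *: a).
Proof.
move=> Ua; rewrite -[_ *: _]addr0; apply: unitizationZD => //.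
by apply: sub_unitization; exact: jalg0.
Qed.

Lemma one_notin : ~ A 1.
Proof. by move=> A1; apply: A_nonunital; exists 1; split=> // a _; exact: jprod1. Qed.

Lemma unitization_unit : is_jordan_unit U 1.
Proof. by split=> [|a _]; [exact: unitization1|exact: jprod1]. Qed.

Lemma jprodDr a b c : jprod a (b + c) = jprod a b + jprod a c.
Proof. by rewrite /jprod mulrDl mulrDr -scalerDr addrACA. Qed.

Lemma jprodZr z a b : jprod a (z *: b) = z *: jprod a b.
Proof.
by rewrite /jprod -bop_scalerAl -bop_scalerAr -scalerDr !scalerA mulrC.
Qed.

Lemma jprodC a b : jprod a b = jprod b a.
Proof. by rewrite /jprod addrC. Qed.

Lemma unitization_jprod b c : U b -> U c -> U (jprod b c).
Proof.
move=> /unitizationP[a [x [Aa ->]]] /unitizationP[a' [x' [Aa' ->]]].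
apply/unitizationP.
exists (jprod a a' + x *: a' + x' *: a), (x' * x); split.
  by apply: jalgD => //; [apply: jalgD|] => //;
     [exact: jalg_jprod|exact: jalgZ|exact: jalgZ].
rewrite jprodDr jprodZr (jprodC _ 1) jprod1 scalerDr scalerA !addrA.
by rewrite jprodC jprodDr jprodZr (jprodC a' 1) jprod1 (jprodC a').
Qed.

Lemma unitization_triple e c : A e -> U c -> A (e * c * e).
Proof.
move=> Ae /unitizationP[a [z [Aa ->]]].
rewrite mulrDr mulrDl; apply: jalgD => //; first exact: jalg_triple.
rewrite -bop_scalerAr -bop_scalerAl mulr1; apply: (jalgZ AJ).
by rewrite -jprodxx; exact: jalg_jprod.
Qed.

Lemma unitization_palindrome a c : U a -> U c -> U (a * c * a).
Proof.
move=> Ua Uc; rewrite jprod_tripleE; apply: unitizationB; last first.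
  by apply: unitization_jprod => //; exact: unitization_jprod.
by apply: unitizationZ; apply: unitization_jprod => //; exact: unitization_jprod.
Qed.

(** The Neumann series [1 + y + y ^+ 2 + ...] of [y = scal (1 - r) - d]. Its
    partial sums are polynomials in [d], so the Jordan product controls them. *)
Lemma unitization_inverse d (r M : R) : A d -> 0 < r -> 0 <= M < 1 ->
  rnorm (scal (1 - r) - d) <= M ->
  exists c, [/\ U c, (scal r + d) * c = 1, c * (scal r + d) = 1 &
                rnorm c <= (1 - M)^-1].
Proof.
move=> Ad r0 /andP[M0 M1] dM.
have [y yD] : exists y, y = scal (1 - r) - d by exists (scal (1 - r) - d).
rewrite -yD in dM.
have yE : scal r + d = 1 - y.
  by rewrite yD /scal rmorphB scalerBl scale1r opprB addrA addrAC opprB addrCA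
    subrr addr0 addrC.
pose s n := iter n (fun c : bounded_op H => 1 + y * c) 0.
have sS n : s n.+1 = 1 + y * s n by [].
have sC n : s n * y = y * s n.
  elim: n => [|n IH]; first by rewrite mul0r mulr0.
  by rewrite sS mulrDl mulrDr mul1r mulr1 -mulrA IH.
have sd n : rnorm (s n.+1 - s n) <= 1 * M ^+ n.
  rewrite mul1r; elim: n => [|n IH].
    by rewrite sS mulr0 addr0 subr0 expr0 rnorm_bop1.
  rewrite sS (sS n) opprD addrACA subrr add0r -mulrBr exprS.
  by rewrite (le_trans (rnorm_bopM _ _))// ler_pM ?rnorm_ge0.
have [c cs] := geometric_cvg ler01 M0 M1 sd.
have cE (p q : bounded_op H) : (forall n, rnorm (p - q) <=
    (1 / (1 - M) * 2) * M ^+ n) -> p = q.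
  move=> pq; apply/eqP; rewrite -subr_eq0; apply/eqP/rnorm0_eq0/eqP.
  rewrite eq_le rnorm_ge0 andbT; apply/ler_addgt0Pr => eps eps0.
  have [n nE] := expr_small (1 / (1 - M) * 2) M0 M1 eps0.
  by rewrite add0r (le_trans (pq n)).
have D0 : 0 <= 1 / (1 - M) by rewrite divr_ge0// subr_ge0 ltW.
have csn n : 1 / (1 - M) * M ^+ n.+1 <= 1 / (1 - M) * M ^+ n.
  by rewrite ler_wpM2l// exprS ler_piMl ?exprn_ge0// ltW.
have M1' := ltW M1.
have yM p : rnorm (y * p) <= M * rnorm p.
  by rewrite (le_trans (rnorm_bopM _ _))// ler_wpM2r ?rnorm_ge0.
have My p : rnorm (p * y) <= M * rnorm p.
  by rewrite (le_trans (rnorm_bopM _ _))// mulrC ler_wpM2r ?rnorm_ge0.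
have Mle (p : bounded_op H) : M * rnorm p <= rnorm p.
  by rewrite ler_piMl ?rnorm_ge0.
have c1 : c = 1 + y * c.
  apply: cE => n; rewrite (le_trans (rdistD (s n.+1) _ _))//.
  have -> : s n.+1 - (1 + y * c) = y * (s n - c).
    by rewrite sS opprD addrACA subrr add0r -mulrBr.
  have h1 := cs n.+1; have h2 := csn n; have h3 := cs n.
  have := yM (s n - c); have := Mle (s n - c); rewrite (rdistC (s n) c); lra.
have c2 : c = 1 + c * y.
  apply: cE => n; rewrite (le_trans (rdistD (s n.+1) _ _))//.
  have -> : s n.+1 - (1 + c * y) = (s n - c) * y.
    by rewrite sS -sC opprD addrACA subrr add0r -mulrBl.
  have h1 := cs n.+1; have h2 := csn n; have h3 := cs n.
  have := My (s n - c); have := Mle (s n - c); rewrite (rdistC (s n) c); lra.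
have gc : (scal r + d) * c = 1 by rewrite yE mulrBl mul1r {1}c1 addrK.
have cg : c * (scal r + d) = 1 by rewrite yE mulrBr mulr1 {1}c2 addrK.
(* As [d] commutes with [s n], each [d * s n] is a Jordan polynomial in [d]
   without constant term. *)
have Ads n : A (d * s n) /\ s n * d = d * s n.
  elim: n => [|n [Adn dn]]; first by rewrite mulr0 mul0r; split=> //; exact: jalg0.
  have e1 : d * s n.+1 = d + ((1 - r)%:C *: (d * s n) - jprod d (d * s n)).
    rewrite jprod_comm; last by rewrite -mulrA dn.
    rewrite sS -sC mulrDr mulr1 yD mulrBr dn -scal_mulC /scal -bop_scalerAl mul1r.
    by rewrite mulrBr -bop_scalerAr.
  split.
    by rewrite e1; apply: jalgD => //; apply: jalgB => //; [exact: jalgZ|exact: jalg_jprod].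
  have yd : y * d = d * y by rewrite yD mulrBl mulrBr scal_mulC.
  by rewrite sS mulrDl mulrDr mul1r mulr1 -mulrA dn mulrA yd mulrA.
have Adc : A (d * c).
  apply: (@closed_cvg _ _ _ (@eventually_filter) (fun n => d * s n) A (jalg_closed AJ)).
    by exists 0%N => // n _; case: (Ads n).
  apply/rnorm_cvgP => eps eps0.
  have [n nE] := expr_small (rnorm d * (1 / (1 - M))) M0 M1 eps0.
  exists n => // m /= nm; rewrite -mulrBr (le_trans (rnorm_bopM _ _))//.
  apply: le_trans nE; rewrite -mulrA ler_wpM2l ?rnorm_ge0//.
  rewrite (le_trans (cs m))// ler_wpM2l//; exact: ler_wiXn2l.
exists c; split=> //.
(* [scal r * c + d * c = 1] expresses [c] through [d * c]. *)
- have -> : c = (r^-1)%:C *: (1 - d * c).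
    have <- : scal r * c = 1 - d * c by rewrite -gc mulrDl addrK.
    rewrite /scal -bop_scalerAl mul1r scalerA -rmorphM mulVf ?scale1r//.
    by rewrite gt_eqF.
  rewrite -[_ *: _]addr0; apply: unitizationZD.
    by apply: unitizationB; [exact: unitization1|exact: sub_unitization].
  by apply: sub_unitization; exact: jalg0.
- have := cs 0%N; rewrite subr0 expr0 mulr1 div1r; exact.
Qed.

Section Embedding.
Variables (D : cstarAlgType R) (j : bounded_op H -> D).
Hypothesis jU : jordan_embedding U j.

Lemma embedZD z a b : U a -> U b -> j (z *: a + b) = z *: j a + j b.
Proof. by case: jU => + _ _; apply. Qed.

Lemma embed_jprod a b : U a -> U b -> j (jprod a b) = jordan (j a) (j b).
Proof. by case: jU => _ _; apply. Qed.

Lemma embedD a b : U a -> U b -> j (a + b) = j a + j b.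
Proof. by move=> Ua Ub; have := embedZD 1 Ua Ub; rewrite !scale1r. Qed.

Lemma embed0 : j 0 = 0.
Proof.
have U0 : U 0 by apply: sub_unitization; exact: jalg0.
by have := embedD U0 U0; rewrite addr0 -{1}[j 0]addr0 => /addrI.
Qed.

Lemma embedZ z a : U a -> j (z *: a) = z *: j a.
Proof.
move=> Ua; have U0 : U 0 by apply: sub_unitization; exact: jalg0.
by have := embedZD z Ua U0; rewrite embed0 !addr0.
Qed.

Lemma embedB a b : U a -> U b -> j (a - b) = j a - j b.
Proof.
by move=> Ua Ub; rewrite addrC -scaleN1r embedZD// scaleN1r addrC.
Qed.

Lemma embed_triple a b : U a -> U b ->
  j (a * b * a) = cmul (cmul (j a) (j b)) (j a).
Proof.
move=> Ua Ub; have Uab := unitization_jprod Ua Ub.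
have Uaa := unitization_jprod Ua Ua.
have U1 := unitization_jprod Uab Ua; have U2 := unitization_jprod Uaa Ub.
rewrite cmul_triple jprod_tripleE embedB//; last exact: unitizationZ.
by rewrite (embedZ _ U1) !embed_jprod.
Qed.

(** The Jordan product of [g] and [c] and the triple products [g c g] and [c g c]
    are preserved by [j], and determine the product of [j g] and [j c]. *)
Lemma embed_inverse g c : U g -> U c -> g * c = 1 -> c * g = 1 ->
  cmul (j g) (j c) = j 1.
Proof.
move=> Ug Uc gc cg; have U1 := unitization1.
have j1 a : U a -> cmul (j 1) (j a) = j a /\ cmul (j a) (j 1) = j a.
  by move=> Ua; apply: jordan_unit_cmul; rewrite -embed_jprod// jprod1.
apply: jordan_inverse_cmul; [exact: (j1 g _).1|exact: (j1 c _).1|exact: (j1 g _).2| | |].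
- by rewrite -embed_jprod// jprod_comm gc// cg.
- by rewrite -embed_triple// gc mul1r.
- by rewrite -embed_triple// cg mul1r.
Qed.

End Embedding.

End Unitization.

Section UnitalExtension.
Context {R : realType} {H : hilbertType R} {X : completeNormedModType R[i]}.
Variables (A : set (bounded_op H)) (AJ : jordan_operator_algebra A).
Hypothesis A_nonunital : ~ unital A.
Variables (I : directedSet) (e : I -> bounded_op H) (e_cai : partial_cai A e).
Implicit Types (a b c g : bounded_op H) (z : R[i]) (x y : X).

Local Notation U := (unitization A).

(** What the associativity of a left or of a right module action says about
    products that read the same in both directions; unlike associativity it
    does not distinguish left from right. *)
Record palindromic (L : bounded_op H -> X -> X) : Prop := {
  palindromic_triple : forall a c x, U a -> U c -> L (a * c * a) x = L a (L c (L a x));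
  palindromic_inverse : forall g c x, U g -> U c -> g * c = 1 -> c * g = 1 ->
    L g (L c x) = L 1 x
}.

Lemma left_multiplicative_palindromic (D : cstarAlgType R)
    (j : bounded_op H -> D) (l : bounded_op H -> X -> X) :
  jordan_embedding U j -> left_multiplicative A j l ->
  palindromic (left_unital_ext A l).
Proof.
move=> jU lj; split=> [a c x Ua Uc|g c x Ug Uc gc cg].
  rewrite (lj a [:: c; a])//=.
  - by move=> b; rewrite !inE => /or3P[] /eqP->.
  - exact: unitization_palindrome.
  - exact: (embed_triple AJ A_nonunital jU).
rewrite (lj g [:: c] 1)//=.
- by move=> b; rewrite !inE => /orP[] /eqP->.
- exact: unitization1.
- exact/esym/(embed_inverse AJ A_nonunital jU).
Qed.

Lemma right_multiplicative_palindromic (D : cstarAlgType R)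
    (j : bounded_op H -> D) (r : X -> bounded_op H -> X) :
  jordan_embedding U j -> right_multiplicative A j r ->
  palindromic (left_unital_ext A (fun a x => r x a)).
Proof.
move=> jU rj; split=> [a c x Ua Uc|g c x Ug Uc gc cg].
  rewrite -[LHS]/(right_unital_ext A r x _) (rj a [:: c; a])//=.
  - by move=> b; rewrite !inE => /or3P[] /eqP->.
  - exact: unitization_palindrome.
  - exact: (embed_triple AJ A_nonunital jU).
rewrite -[RHS]/(right_unital_ext A r x _) (rj c [:: g] 1)//=.
- by move=> b; rewrite !inE => /orP[] /eqP->.
- exact: unitization1.
- exact/esym/(embed_inverse AJ A_nonunital jU).
Qed.

(** Convergence in the strong topology of the action [L]. *)
Definition strong_limit T (F : set_system T) (L : bounded_op H -> X -> X)
    (gs : T -> bounded_op H) g : Prop :=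
  [/\ forall t, U (gs t), exists K, forall t, rnorm (gs t) <= K &
      forall x (eps : R), 0 < eps ->
        \forall t \near F, rnorm (L (gs t) x - L g x) <= eps].

Section Action.
Variables (l : bounded_op H -> X -> X) (lA : left_premodule A l).
Hypothesis el : forall x, l (e t) x @[t --> tails I] --> x.

Local Notation L := (left_unital_ext A l).
Hypothesis Lpal : palindromic L.

Lemma ext_addE a z x : A a -> L (a + z *: (1 : bounded_op H)) x = l a x + z *: x.
Proof.
move=> Aa; rewrite /left_unital_ext asboolF//.
case: xgetP => [[b w] _ [/= Ab azbw]|/(_ (a, z))[]//=].
have [zw|zw] := eqVneq z w.
  by move: azbw; rewrite zw => /addIr ->.
exfalso; apply: (one_notin A_nonunital).
have -> : (1 : bounded_op H) = (w - z)^-1 *: (a - b).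
  have -> : a - b = (w - z) *: (1 : bounded_op H).
    rewrite scalerBl; apply/eqP; rewrite subr_eq addrAC eq_sym subr_eq.
    by rewrite [X in _ == X]azbw addrC.
  by rewrite scalerA mulVf ?scale1r// subr_eq0 eq_sym.
by apply: (jalgZ AJ); exact: (jalgB AJ).
Qed.

Lemma ext_mem a x : A a -> L a x = l a x.
Proof. by move=> Aa; have := ext_addE 0 x Aa; rewrite !scale0r !addr0. Qed.

Lemma ext1 x : L 1 x = x.
Proof.
have := ext_addE 1 x (jalg0 AJ); rewrite add0r scale1r => ->.
have [_ lD _] := lA.
have := lD 1 0 0 x (jalg0 AJ) (jalg0 AJ); rewrite !scale1r addr0.
by rewrite -{1}[l 0 x]addr0 => /addrI <-; rewrite add0r.
Qed.

Lemma ext_inverse g c x : U g -> U c -> g * c = 1 -> c * g = 1 -> L g (L c x) = x.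
Proof. by move=> Ug Uc gc cg; rewrite (palindromic_inverse Lpal)// ext1. Qed.

Lemma ext_ZDl z c c' x : U c -> U c' -> L (z *: c + c') x = z *: L c x + L c' x.
Proof.
move=> /(unitizationP A_nonunital)[a [w [Aa ->]]].
move=> /(unitizationP A_nonunital)[a' [w' [Aa' ->]]].
have -> : z *: (a + w *: (1 : bounded_op H)) + (a' + w' *: (1 : bounded_op H)) =
    (z *: a + a') + (z * w + w') *: (1 : bounded_op H).
  by rewrite scalerDr scalerA scalerDl addrACA.
rewrite !ext_addE//; last exact: jalgZD.
have [_ lD _] := lA; rewrite lD//.
by rewrite scalerDr scalerA scalerDl addrACA.
Qed.

Lemma ext_Bl c c' x : U c -> U c' -> L (c - c') x = L c x - L c' x.
Proof.
by move=> Uc Uc'; rewrite addrC -scaleN1r ext_ZDl// scaleN1r addrC.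
Qed.

Lemma ext_ZDr z c x y : U c -> L c (z *: x + y) = z *: L c x + L c y.
Proof.
move=> /(unitizationP A_nonunital)[a [w [Aa ->]]]; rewrite !ext_addE//.
have [ll _ _] := lA; rewrite (ll a Aa z x y) !scalerDr !scalerA (mulrC w).
by rewrite addrACA.
Qed.

Lemma ext_Br c x y : U c -> L c (x - y) = L c x - L c y.
Proof.
by move=> Uc; rewrite addrC -scaleN1r ext_ZDr// scaleN1r addrC.
Qed.

Lemma rnorm_act a x : A a -> rnorm (l a x) <= rnorm a * rnorm x.
Proof.
by move=> Aa; have [_ _ lc] := lA; have := lc a x Aa; rewrite !rnormE -rmorphM lecR.
Qed.

Lemma ext_bounded c : U c -> exists2 K : R, 0 <= K & forall x, rnorm (L c x) <= K * rnorm x.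
Proof.
move=> /(unitizationP A_nonunital)[a [w [Aa ->]]].
have w0 := Re_norm_ge0 w.
exists (rnorm a + complex.Re `|w|) => [|x]; first by rewrite addr_ge0 ?rnorm_ge0.
rewrite ext_addE// (le_trans (rnormD _ _))// mulrDl lerD ?rnorm_act//.
by rewrite rnormZc.
Qed.

(** The sandwiches [e t * c * e t] lie in [A] although [e t * c] need not, so they
    replace [e t * c] throughout. *)
Lemma ext_sandwich c x (eps : R) : U c -> 0 < eps ->
  \forall t \near tails I, rnorm (L (e t * c * e t) x - L c x) <= eps.
Proof.
move=> Uc eps0; have Ae := cai_mem e_cai.
have Ue t : U (e t) by exact: (sub_unitization A_nonunital).
have [K K0 cK] := ext_bounded Uc.
have /rnorm_cvgP e1 := @el x; have /rnorm_cvgP e2 := @el (L c x).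
have eps2 : 0 < eps / 2 by rewrite divr_gt0.
have epsK : 0 < eps / (2 * (K + 1)) by rewrite divr_gt0// mulr_gt0// ltr_wpDl.
apply: filterS (filterI (e1 _ epsK) (e2 _ eps2)) => t [t1 t2].
rewrite (palindromic_triple Lpal)// !(ext_mem _ (Ae t)) rdistC.
rewrite (le_trans (rdistD (l (e t) (L c x)) _ _))// [leRHS]splitr lerD//.
rewrite -!(ext_mem _ (Ae t)) -ext_Br// -ext_Br// !(ext_mem _ (Ae t)).
rewrite (le_trans (rnorm_act _ (Ae t)))//.
rewrite (le_trans (ler_wpM2r (rnorm_ge0 _) (cai_rnorm e_cai t)))// mul1r.
rewrite (le_trans (cK _))// (le_trans (ler_wpM2l K0 t1))//.
have K1 : 0 < K + 1 by rewrite ltr_wpDl.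
rewrite invfM [X in K * X]mulrA mulrCA ler_piMr ?(ltW eps2)//.
by rewrite ler_pdivrMr// mul1r lerDl.
Qed.

(** Only elements of [A] are assumed to act contractively; the estimate passes to
    [c] in the unitization along the sandwiches [e t * c * e t]. *)
Lemma rnorm_ext c x : U c -> rnorm (L c x) <= rnorm c * rnorm x.
Proof.
move=> Uc; have sw : L (e t * c * e t) x @[t --> tails I] --> L c x.
  by apply/rnorm_cvgP => eps /(ext_sandwich x Uc); apply: filterS => t; rewrite rdistC.
rewrite -[L c x]subr0; apply: (rnorm_limit_le sw); apply: nearW => t.
have Ae := cai_mem e_cai t.
have e1 := cai_rnorm e_cai t.
have Aece : A (e t * c * e t) by exact: unitization_triple.
rewrite subr0 ext_mem// (le_trans (rnorm_act _ _))// ler_wpM2r ?rnorm_ge0//.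
rewrite (le_trans (rnorm_bopM _ _))// -[leRHS]mulr1 ler_pM ?rnorm_ge0//.
by rewrite (le_trans (rnorm_bopM _ _))// ler_piMl ?rnorm_ge0.
Qed.

Lemma strong_limit_norm T (F : set_system T) {FF : Filter F}
    (gs : T -> bounded_op H) g :
  (forall t, U (gs t)) -> (exists K, forall t, rnorm (gs t) <= K) -> U g ->
  (forall eps : R, 0 < eps -> \forall t \near F, rnorm (gs t - g) <= eps) ->
  strong_limit F L gs g.
Proof.
move=> Ugs Kgs Ug gsg; split=> // x eps eps0.
have x1 : 0 < rnorm x + 1 by rewrite ltr_wpDl ?rnorm_ge0.
have ex : 0 < eps / (rnorm x + 1) by rewrite divr_gt0.
apply: filterS (gsg _ ex) => t gt; rewrite -ext_Bl//.
rewrite (le_trans (rnorm_ext _ _))//; first exact: unitizationB.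
rewrite (le_trans (ler_wpM2r (rnorm_ge0 _) gt))// mulrAC ler_pdivrMr//.
by rewrite ler_wpM2l ?(ltW eps0)// lerDl.
Qed.

Lemma strong_limit_perturb g (w : R) : U g ->
  strong_limit (tails I) L (fun t => g + w%:C *: (e t - 1)) g.
Proof.
move=> Ug; have Ae := cai_mem e_cai.
have U1 : U 1 by exact: unitization1.
have Ue t : U (e t) by exact: (sub_unitization A_nonunital).
have Ue1 t : U (e t - 1) by exact: unitizationB.
split=> [t||x eps eps0].
- by rewrite addrC; exact: unitizationZD.
- exists (rnorm g + `|w| * 2) => t.
  rewrite (le_trans (rnormD _ _))// lerD2l rnormZ ler_wpM2l//.
  rewrite (le_trans (rnormB _ _))//.
  by rewrite (le_trans (lerD (cai_rnorm e_cai t) (rnorm_bop1 (H := H)))).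
have w1 : 0 < `|w| + 1 by rewrite ltr_wpDl.
have ew : 0 < eps / (`|w| + 1) by rewrite divr_gt0.
have /rnorm_cvgP /(_ _ ew) := @el x; apply: filterS => t te.
rewrite (addrC g) ext_ZDl// addrK ext_Bl// ext1 ext_mem// rnormZ rdistC.
rewrite (le_trans (ler_wpM2l (normr_ge0 w) te))// mulrCA ler_piMr ?(ltW eps0)//.
by rewrite ler_pdivrMr// mul1r lerDl.
Qed.

Lemma strong_limit_sandwich c : U c ->
  strong_limit (tails I) L (fun t => e t * c * e t) c.
Proof.
move=> Uc; split=> [t||x eps eps0]; last exact: ext_sandwich.
  apply: (sub_unitization A_nonunital); apply: unitization_triple => //.
  exact: (cai_mem e_cai).
exists (rnorm c) => t; have e1 := cai_rnorm e_cai t.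
rewrite (le_trans (rnorm_bopM _ _))// -[leRHS]mulr1 ler_pM ?rnorm_ge0//.
by rewrite (le_trans (rnorm_bopM _ _))// ler_piMl ?rnorm_ge0.
Qed.

End Action.

End UnitalExtension.

(** * Cohen's construction *)

Section Factors.
Context {R : realType} {H : hilbertType R} {X : completeNormedModType R[i]}.
Variables (A : set (bounded_op H)) (u : bounded_op H).
Variables (P : bounded_op H -> X -> X) (b : X).

(** The closure of the orbit in metric form, which is how it is produced. *)
Definition in_orbit_closure (x : X) : Prop :=
  forall eps : R, 0 < eps -> exists2 c, A c & rnorm (x - P c b) <= eps.

Definition factors : Prop := exists (b0 : X) (a : bounded_op H),
  [/\ [/\ A a, rnorm a < 1 & rnorm (u - a) <= 1], P a b0 = b,
      (rnorm b < 1 -> rnorm b0 < 1) & in_orbit_closure b0].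

End Factors.

Section Factorization.
Context {R : realType} {H : hilbertType R} {X : completeNormedModType R[i]}.
Variables (A : set (bounded_op H)) (AJ : jordan_operator_algebra A).
Hypothesis A_nonunital : ~ unital A.
Variables (I : directedSet) (e : I -> bounded_op H) (e_cai : partial_cai A e).
Implicit Types (a b c d g : bounded_op H) (x y : X) (r w eps : R).

Local Notation U := (unitization A).

(** The common ground of [x |-> c x] and [x |-> c x c], on which the
    factorization is carried out once for both; the latter is quadratic in [c],
    whence the square in [action_bound]. *)
Record factorizing_action (P : bounded_op H -> X -> X) : Prop := {
  action_sub : forall c x y, U c -> P c (x - y) = P c x - P c y;
  action_bound : forall c (K : R) x, U c -> 1 <= K -> rnorm c <= K ->
    rnorm (P c x) <= K ^+ 2 * rnorm x;
  action_inverse : forall g c x, U g -> U c -> g * c = 1 -> c * g = 1 ->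
    P g (P c x) = x;
  action_norm : forall (gs : nat -> bounded_op H) g x eps,
    (forall n, U (gs n)) -> (exists K, forall n, rnorm (gs n) <= K) -> U g ->
    (forall del : R, 0 < del -> \forall n \near \oo, rnorm (gs n - g) <= del) ->
    0 < eps -> \forall n \near \oo, rnorm (P (gs n) x - P g x) <= eps;
  action_perturb : forall g w x eps, U g -> 0 < eps ->
    \forall t \near tails I, rnorm (P (g + w%:C *: (e t - 1)) x - P g x) <= eps;
  action_sandwich : forall c x eps, U c -> 0 < eps ->
    \forall t \near tails I, rnorm (P (e t * c * e t) x - P c x) <= eps
}.

Lemma dependent_choice_nat (S : Type) (Inv : nat -> S -> Prop)
    (Step : nat -> S -> S -> Prop) (s0 : S) : Inv 0%N s0 ->
  (forall n s, Inv n s -> exists s', Inv n.+1 s' /\ Step n s s') ->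
  exists f : nat -> S,
    [/\ f 0%N = s0, forall n, Inv n (f n) & forall n, Step n (f n) (f n.+1)].
Proof.
move=> I0 IS.
have next n (s : {s | Inv n s}) :
    {s' : {s' | Inv n.+1 s'} | Step n (projT1 s) (projT1 s')}.
  case: s => s Is; have [s' [Is' ss']] := cid (IS n s Is).
  by exists (exist _ s' Is').
pose fix f n : {s | Inv n s} :=
  if n is m.+1 then projT1 (next m (f m)) else exist _ s0 I0.
exists (fun n => projT1 (f n)); split=> // n; first exact: (projT2 (f n)).
by rewrite /=; case: (next n (f n)).
Qed.

(** By the inequality of arithmetic and geometric means, the square of
    [(1 + be) / 2] exceeds [be]. *)
Lemma shrinking_factor (be : R) : 0 <= be ->
  exists rho : R, [/\ 0 < rho, rho < 1 & be < 1 -> rho^-1 ^+ 2 * be < 1].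
Proof.
move=> be0; have [b1|b1] := ltP be 1; last first.
  by exists 2^-1; split; [rewrite invr_gt0|lra|by []].
exists ((1 + be) / 2); split; [lra|lra|move=> _].
rewrite exprVn mulrC ltr_pdivrMr ?exprn_gt0//; last lra.
have : 0 < (1 - be) ^+ 2 by rewrite exprn_gt0// subr_gt0.
rewrite mul1r; lra.
Qed.

Variables (P : bounded_op H -> X -> X) (PA : factorizing_action P) (b : X).
Local Notation in_orbit_closure := (in_orbit_closure A P b).

Lemma orbit_closure_unitization c : U c -> in_orbit_closure (P c b).
Proof.
move=> Uc eps eps0.
have [t te] := @filter_ex _ (tails I) _ _ (action_sandwich PA b Uc eps0).
exists (e t * c * e t); last by rewrite rdistC.
by apply: (unitization_triple AJ A_nonunital) => //; exact: (cai_mem e_cai).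
Qed.

(** One step of the construction. The element [scal r + d] of the unitization
    has [scal r] replaced by a smaller scalar and a multiple of a late [e t]. In
    [rnorm (scal (1 - r) - d) <= 1 - r / 4] the gap to [1] bounds the next inverse
    before [t] is chosen, so [t] can be taken late enough for the solution [y] of
    [(scal r + d) y = b] to move as little as desired. *)
Lemma cohen_step r d x eps : 0 < r -> r <= 1 -> A d ->
  rnorm (scal (1 - r) - d) <= 1 - r / 4 -> P (scal r + d) x = b -> 0 < eps ->
  exists d' x',
    [/\ [/\ A d', rnorm (d' - d) <= r / 4 &
            rnorm (scal (1 - 3 / 4 * r) - d') <= 1 - 3 / 4 * r / 4],
        P (scal (3 / 4 * r) + d') x' = b, in_orbit_closure x' &
        rnorm (x' - x) <= eps].
Proof.
move=> r0 r1 Ad dM Px eps0; set r' := 3 / 4 * r.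
have r'0 : 0 < r' by rewrite /r'; lra.
pose K := (1 - (1 - r' / 4))^-1.
have KE : K = 4 / r'.
  by rewrite /K subKr invf_div.
have K1 : 1 <= K by rewrite KE ler_pdivlMr// mul1r /r'; lra.
have K20 : 0 < K ^+ 2 by rewrite exprn_gt0// (lt_le_trans _ K1).
have Ug : U (scal r + d).
  by apply: (unitizationD AJ A_nonunital) => //;
    [exact: (unitization_scal AJ A_nonunital)|exact: (sub_unitization A_nonunital)].
have w0 : 0 < r / 4 by rewrite divr_gt0.
have near1 : \forall t \near tails I,
    rnorm (scal (1 - r) - d + (r / 4)%:C *: (1 - e t)) <= 1 - r' / 4.
  apply: (cai_norm_step e_cai (N := 1 - r / 4)) => //; rewrite ?/r'; lra.
have epsK : 0 < eps / K ^+ 2 by rewrite divr_gt0.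
have near2 := action_perturb PA (r / 4) x Ug epsK.
have [t [t1 t2]] := @filter_ex _ (tails I) _ _ (filterI near1 near2).
have Aet := cai_mem e_cai t.
pose d' := d + (r / 4)%:C *: e t.
have Ad' : A d' by apply: (jalgD AJ) => //; exact: (jalgZ AJ).
have rr : r = r' + r / 4 by rewrite /r'; field.
have scalD (p q : R) : scal (p + q) = scal p + scal q :> bounded_op H.
  by rewrite /scal rmorphD scalerDl.
have g'E : scal r + d + (r / 4)%:C *: (e t - 1) = scal r' + d'.
  rewrite {1}rr scalD scalerBr /d' -/(scal (r / 4)).
  by rewrite !addrA [LHS](ACl (1*3*4*2*5))/= addrK.
have d'M : rnorm (scal (1 - r') - d') <= 1 - r' / 4.
  have <- // : scal (1 - r) - d + (r / 4)%:C *: (1 - e t) = scal (1 - r') - d'.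
  have -> : 1 - r' = 1 - r + r / 4 by rewrite /r'; field.
  by rewrite (scalD (1 - r)) scalerBr /d' -/(scal (r / 4)) opprD addrACA.
have [c [Uc gc cg cK]] : exists c, [/\ U c, (scal r' + d') * c = 1,
    c * (scal r' + d') = 1 & rnorm c <= K].
  apply: (unitization_inverse AJ A_nonunital Ad' r'0 _ d'M).
  by rewrite /r'; lra.
have Ug' : U (scal r' + d').
  by apply: (unitizationD AJ A_nonunital) => //;
    [exact: (unitization_scal AJ A_nonunital)|exact: (sub_unitization A_nonunital)].
exists d', (P c b); split; last first.
- have -> : P c b - x = P c (b - P (scal r' + d') x).
    by rewrite (action_sub PA)// (action_inverse PA).
  rewrite (le_trans (action_bound PA _ Uc K1 cK))// mulrC -ler_pdivlMr//.
  by rewrite rdistC -g'E -[X in _ - X]Px.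
- exact: orbit_closure_unitization.
- exact: (action_inverse PA).
- split=> //; rewrite /d' addrC addKr rnormZ gtr0_norm// ler_piMr ?(ltW w0)//.
  exact: (cai_rnorm e_cai).
Qed.

(** Starting from [scal rho] rather than [1] makes the norm of the final [a] at
    most [rho], at the price of the first solution being [rho^-1] times, or
    [rho^-1 ^+ 2] times, as large as [b]. *)
Lemma cohen_factorization : factors A 1 P b.
Proof.
have [rho [rho0 rho1 rhob]] := shrinking_factor (rnorm_ge0 b).
have [eta eta0 etab] : exists2 eta : R, 0 < eta &
    rnorm b < 1 -> (rho^-1) ^+ 2 * rnorm b + 2 * eta < 1.
  have [b1|b1] := ltP (rnorm b) 1; last first.
    by exists 1.
  have := rhob b1 => h; exists ((1 - rho^-1 ^+ 2 * rnorm b) / 4); first by lra.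
  by move=> _; lra.
(* The [n]-th element of the unitization is [scal (rr n)] plus an element of
   [A]. *)
pose rr n : R := rho * (3 / 4) ^+ n.
have rrS n : rr n.+1 = 3 / 4 * rr n by rewrite /rr exprS mulrCA.
have q0 : 0 <= 3 / 4 :> R by lra.
have q1 : 3 / 4 < 1 :> R by lra.
have rr0 n : 0 < rr n by rewrite /rr mulr_gt0// exprn_gt0//; lra.
have rrrho n : rr n <= rho.
  by rewrite /rr ler_piMr ?(ltW rho0)// exprn_ile1// ltW.
have rr1 n : rr n <= 1 by rewrite (le_trans (rrrho n))// ltW.
pose Inv n (s : bounded_op H * X) :=
  [/\ [/\ A s.1, rnorm (scal (1 - rr n) - s.1) <= 1 - rr n / 4 &
          rnorm s.1 <= rho - rr n],
      P (scal (rr n) + s.1) s.2 = b & in_orbit_closure s.2].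
pose Step n (s s' : bounded_op H * X) :=
  rnorm (s'.1 - s.1) <= rho / 4 * (3 / 4) ^+ n /\
  rnorm (s'.2 - s.2) <= eta * 2^-1 ^+ n.
have A0 := jalg0 AJ.
have U_scal r : U (scal r) by exact: (unitization_scal AJ A_nonunital).
have rhoV : scal rho * scal rho^-1 = 1 :> bounded_op H.
  by rewrite -scalM mulfV ?gt_eqF// /scal scale1r.
have rhoV' : scal rho^-1 * scal rho = 1 :> bounded_op H by rewrite scal_mulC.
have I0 : Inv 0%N (0, P (scal rho^-1) b).
  split=> /=; last exact: orbit_closure_unitization.
    rewrite /rr expr0 mulr1 subr0 subrr rnorm0; split=> //.
    by rewrite (le_trans (rnorm_scal _))//; lra.
  by rewrite /rr expr0 mulr1 addr0; exact: (action_inverse PA).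
have IS n s : Inv n s -> exists s', Inv n.+1 s' /\ Step n s s'.
  case: s => d x [/= [Ad dM dr] Px xb].
  have etan : 0 < eta * 2^-1 ^+ n by rewrite mulr_gt0// exprn_gt0// invr_gt0.
  have [d' [x' [[Ad' dd' d'M] Px' x'b xx']]] :=
    cohen_step (rr0 n) (rr1 n) Ad dM Px etan.
  exists (d', x'); split; split=> //=; rewrite ?rrS//.
    split=> //; rewrite -(subrK d d') (le_trans (rnormD _ _))//.
    by rewrite (le_trans (lerD dd' dr))//; lra.
  by apply: le_trans dd' _; rewrite /rr mulrAC.
have [f [f0 fI fS]] := dependent_choice_nat I0 IS.
have [a aP] : exists a : bounded_op H, forall n,
    rnorm (a - (f n).1) <= rho / 4 / (1 - 3 / 4) * (3 / 4) ^+ n.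
  apply: (@geometric_cvg _ (bounded_op H) (fun n => (f n).1)) => //.
    by rewrite divr_ge0// ltW.
  by move=> n; case: (fS n).
have [b0 b0P] : exists b0 : X, forall n,
    rnorm (b0 - (f n).2) <= eta / (1 - 2^-1) * 2^-1 ^+ n.
  apply: (@geometric_cvg _ X (fun n => (f n).2)) => //; try lra.
  by move=> n; case: (fS n).
have half1 : 2^-1 < 1 :> R by lra.
have half0 : 0 <= 2^-1 :> R by lra.
have aE : rho / 4 / (1 - 3 / 4) = rho by field.
have bE : eta / (1 - 2^-1) = 2 * eta by field.
rewrite aE in aP; rewrite bE in b0P.
have near_a (eps : R) : 0 < eps -> \forall n \near \oo, rnorm (a - (f n).1) <= eps.
  move=> eps0; have [n nE] := expr_small rho q0 q1 eps0.
  exists n => // m /= nm; rewrite (le_trans (aP m))// (le_trans _ nE)//.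
  by rewrite ler_wpM2l ?(ltW rho0)// ler_wiXn2l// ltW.
have near_b (eps : R) : 0 < eps -> \forall n \near \oo, rnorm (b0 - (f n).2) <= eps.
  move=> eps0; have [n nE] := expr_small (2 * eta) half0 half1 eps0.
  exists n => // m /= nm; rewrite (le_trans (b0P m))// (le_trans _ nE)//.
  by rewrite ler_wpM2l ?mulr_ge0 ?(ltW eta0)// ler_wiXn2l// ltW.
have near_r (eps : R) : 0 < eps -> \forall n \near \oo, rr n <= eps.
  move=> eps0; have [n nE] := expr_small rho q0 q1 eps0.
  exists n => // m /= nm; rewrite (le_trans _ nE)// /rr.
  by rewrite ler_wpM2l ?(ltW rho0)// ler_wiXn2l// ltW.
have cvga : (fun n => (f n).1) @ \oo --> a by exact/rnorm_cvgP.
have Aa : A a.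
  apply: (@closed_cvg _ _ _ (@eventually_filter) (fun n => (f n).1) A
    (jalg_closed AJ)) cvga.
  by apply: nearW => n; case: (fI n) => -[].
have a_rho : rnorm a <= rho.
  rewrite -[a]subr0; apply: (rnorm_limit_le cvga); apply: nearW => n.
  rewrite subr0; case: (fI n) => -[_ _ /le_trans] + _ _; apply.
  by have := rr0 n; lra.
pose gs n := scal (rr n) + (f n).1.
have Ugs n : U (gs n).
  apply: (unitizationD AJ A_nonunital) => //; apply: (sub_unitization A_nonunital) => //.
  by case: (fI n) => -[].
have gs_a (eps : R) : 0 < eps -> \forall n \near \oo, rnorm (gs n - a) <= eps.
  move=> eps0; have e2 : 0 < eps / 2 by rewrite divr_gt0.
  apply: filterS (filterI (near_a _ e2) (near_r _ e2)) => n [na nr].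
  rewrite /gs -addrA (le_trans (rnormD _ _))// rdistC.
  by have := rnorm_scal (H := H) (ltW (rr0 n)); lra.
have gs2 n : rnorm (gs n) <= 2.
  rewrite (le_trans (rnormD _ _))//.
  have := rnorm_scal (H := H) (ltW (rr0 n)); have := rr1 n; have := rr0 n.
  by case: (fI n) => -[_ _]; lra.
have gs_a' : gs @ \oo --> a.
  by apply/rnorm_cvgP => eps /gs_a; apply: filterS => n; rewrite rdistC.
exists b0, a; split.
- split=> //; first by lra.
  rewrite rdistC; apply: (rnorm_limit_le gs_a'); apply: nearW => n.
  rewrite /gs rdistC opprD addrA.
  have -> : 1 - scal (rr n) = scal (1 - rr n) :> bounded_op H.
    by rewrite /scal rmorphB scalerBl scale1r.
  case: (fI n) => -[_ + _] _ _ => /le_trans; apply.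
  by have := rr0 n; lra.
- apply/eqP; rewrite -subr_eq0; apply/eqP/rnorm0_eq0/eqP.
  rewrite eq_le rnorm_ge0 andbT; apply/ler_addgt0Pr => eps eps0; rewrite add0r.
  have e2 : 0 < eps / 2 by rewrite divr_gt0.
  (* [gs n] has norm at most [2], so it acts with norm at most [4]. *)
  have e8 : 0 < eps / 8 by rewrite divr_gt0.
  have gsb := action_norm PA b0 Ugs (ex_intro _ 2 gs2)
    (sub_unitization A_nonunital Aa) gs_a e2.
  have [n [n1 n2]] := @filter_ex _ \oo _ _ (filterI gsb (near_b _ e8)).
  have <- : P (gs n) (f n).2 = b by case: (fI n).
  rewrite (le_trans (rdistD (P (gs n) b0) _ _))// (rdistC (P a b0)) [leRHS]splitr lerD//.
  rewrite -(action_sub PA)//.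
  rewrite (le_trans (action_bound PA _ (Ugs n) (ltac:(lra) : 1 <= (2 : R)) (gs2 n)))//.
  by lra.
- move=> b1; have := etab b1; have := b0P 0%N; rewrite expr0 mulr1 f0 /= => h1 h2.
  have -> : b0 = (b0 - P (scal rho^-1) b) + P (scal rho^-1) b by rewrite subrK.
  rewrite (le_lt_trans (rnormD _ _))//.
  have rV1 : 1 <= rho^-1 by rewrite -[leLHS]invr1 lef_pV2 ?posrE// ltW.
  have := action_bound PA b (U_scal rho^-1) rV1 (rnorm_scal (le_trans ler01 rV1)).
  lra.
- move=> eps eps0; have e2 : 0 < eps / 2 by rewrite divr_gt0.
  have [n n1] := @filter_ex _ \oo _ _ (near_b _ e2).
  have [_ _ /(_ _ e2)[c Ac cn]] := fI n.
  exists c => //; rewrite (le_trans (rdistD (f n).2 _ _))//; lra.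
Qed.

End Factorization.

Section FactorizingActions.
Context {R : realType} {H : hilbertType R} {X : completeNormedModType R[i]}.
Variables (A : set (bounded_op H)) (AJ : jordan_operator_algebra A).
Hypothesis A_nonunital : ~ unital A.
Variables (I : directedSet) (e : I -> bounded_op H) (e_cai : partial_cai A e).

Local Notation U := (unitization A).

Section OneSided.
Variables (l : bounded_op H -> X -> X) (lA : left_premodule A l).
Hypothesis el : forall x, l (e t) x @[t --> tails I] --> x.
Local Notation L := (left_unital_ext A l).
Hypothesis Lpal : palindromic A L.

Lemma ext_factorizing : factorizing_action A e L.
Proof.
split.
- by move=> c x y Uc; exact: (ext_Br AJ A_nonunital lA).
- move=> c K x Uc K1 cK.
  rewrite (le_trans (rnorm_ext AJ A_nonunital e_cai lA el Lpal x Uc))//.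
  rewrite ler_wpM2r ?rnorm_ge0// (le_trans cK)// ler_eXnr//.
- by move=> g c x; exact: (ext_inverse AJ A_nonunital lA Lpal).
- move=> gs g x eps Ugs Kgs Ug gsg.
  by case: (strong_limit_norm AJ A_nonunital e_cai lA el Lpal Ugs Kgs Ug gsg) => _ _; apply.
- move=> g w x eps Ug.
  by case: (strong_limit_perturb AJ A_nonunital e_cai lA el w Ug) => _ _; apply.
- move=> c x eps Uc.
  by case: (strong_limit_sandwich AJ A_nonunital e_cai lA el Lpal Uc) => _ _; apply.
Qed.

End OneSided.

Section TwoSided.
Variables (l r : bounded_op H -> X -> X).
Variables (lA : left_premodule A l) (rA : left_premodule A r).
Hypothesis lr : forall a b x, A a -> A b -> l a (r b x) = r b (l a x).
Hypothesis el : forall x, l (e t) x @[t --> tails I] --> x.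
Hypothesis er : forall x, r (e t) x @[t --> tails I] --> x.
Local Notation L := (left_unital_ext A l).
Local Notation M := (left_unital_ext A r).
Hypothesis Lpal : palindromic A L.
Hypothesis Mpal : palindromic A M.

Lemma ext_commute g c x : U g -> U c -> L g (M c x) = M c (L g x).
Proof.
move=> /(unitizationP A_nonunital)[a [z [Aa ->]]].
move=> /(unitizationP A_nonunital)[b [w [Ab ->]]].
rewrite !(ext_addE AJ A_nonunital)//.
have [ll _ _] := lA; have [rl _ _] := rA.
have lD x' y' : l a (x' + y') = l a x' + l a y'.
  by have := ll a Aa 1 x' y'; rewrite !scale1r.
have rD x' y' : r b (x' + y') = r b x' + r b y'.
  by have := rl b Ab 1 x' y'; rewrite !scale1r.
have lZ v x' : l a (v *: x') = v *: l a x'.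
  have l0 : l a 0 = 0 by have := lD 0 0; rewrite addr0 -{1}[l a 0]addr0 => /addrI.
  by have := ll a Aa v x' 0; rewrite l0 !addr0.
have rZ v x' : r b (v *: x') = v *: r b x'.
  have r0 : r b 0 = 0 by have := rD 0 0; rewrite addr0 -{1}[r b 0]addr0 => /addrI.
  by have := rl b Ab v x' 0; rewrite r0 !addr0.
rewrite lD lZ rD rZ lr// !scalerDr !scalerA (mulrC z) !addrA.
by rewrite [LHS](ACl (1*3*2*4)).
Qed.

(** Joint continuity: the outer actions are uniformly bounded. *)
Lemma strong_limit_comp T (F : set_system T) {FF : Filter F}
    (gs : T -> bounded_op H) g x (eps : R) :
  strong_limit A F L gs g -> strong_limit A F M gs g -> 0 < eps ->
  \forall t \near F, rnorm (M (gs t) (L (gs t) x) - M g (L g x)) <= eps.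
Proof.
move=> [Ugs [K gsK] gL] [_ _ gM] eps0; have K1 : 0 < `|K| + 1 by rewrite ltr_wpDl.
have eps2 : 0 < eps / 2 by rewrite divr_gt0.
have epsK : 0 < eps / 2 / (`|K| + 1) by rewrite divr_gt0.
apply: filterS (filterI (gL x _ epsK) (gM (L g x) _ eps2)) => t [t1 t2].
rewrite (le_trans (rdistD (M (gs t) (L g x)) _ _))// [leRHS]splitr lerD//.
rewrite -(ext_Br AJ A_nonunital rA)//.
rewrite (le_trans (rnorm_ext AJ A_nonunital e_cai rA er Mpal _ (Ugs t)))//.
rewrite mulrC; move: t1; rewrite ler_pdivlMr// => /(le_trans _); apply.
rewrite ler_wpM2l ?rnorm_ge0// (le_trans (gsK t))// (le_trans (ler_norm K))//.
by rewrite lerDl.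
Qed.

Lemma ext2_factorizing : factorizing_action A e (fun c x => M c (L c x)).
Proof.
split.
- by move=> c x y Uc; rewrite (ext_Br AJ A_nonunital lA)// (ext_Br AJ A_nonunital rA).
- move=> c K x Uc K1 cK.
  have K0 : 0 <= K by exact: le_trans K1.
  rewrite (le_trans (rnorm_ext AJ A_nonunital e_cai rA er Mpal _ Uc))//.
  rewrite expr2 -mulrA ler_pM ?rnorm_ge0//.
  rewrite (le_trans (rnorm_ext AJ A_nonunital e_cai lA el Lpal x Uc))//.
  by rewrite ler_wpM2r ?rnorm_ge0.
- move=> g c x Ug Uc gc cg; rewrite ext_commute//.
  by rewrite (ext_inverse AJ A_nonunital lA Lpal)// (ext_inverse AJ A_nonunital rA Mpal).
- move=> gs g x eps Ugs Kgs Ug gsg; apply: strong_limit_comp.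
    exact: (strong_limit_norm AJ A_nonunital e_cai lA el Lpal Ugs Kgs Ug gsg).
  exact: (strong_limit_norm AJ A_nonunital e_cai rA er Mpal Ugs Kgs Ug gsg).
- move=> g w x eps Ug; apply: strong_limit_comp.
    exact: (strong_limit_perturb AJ A_nonunital e_cai lA el w Ug).
  exact: (strong_limit_perturb AJ A_nonunital e_cai rA er w Ug).
- move=> c x eps Uc; apply: strong_limit_comp.
    exact: (strong_limit_sandwich AJ A_nonunital e_cai lA el Lpal Uc).
  exact: (strong_limit_sandwich AJ A_nonunital e_cai rA er Mpal Uc).
Qed.

End TwoSided.

End FactorizingActions.

(** * Unital algebras *)

Section Unital.
Context {R : realType} {H : hilbertType R} {X : completeNormedModType R[i]}.
Variables (A : set (bounded_op H)) (AJ : jordan_operator_algebra A).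
Variables (u : bounded_op H) (Au : is_jordan_unit A u).
Variables (I : directedSet) (e : I -> bounded_op H) (e_cai : partial_cai A e).
Implicit Types (a c : bounded_op H) (x : X).

Lemma unitization_unital c : unitization A c <-> A c.
Proof.
have uA : unital A by exists u.
by split=> [[[]|[]]|]//; left.
Qed.

Lemma unital_unit_unitization : is_jordan_unit (unitization A) u.
Proof.
case: Au => uA uE; split; first exact/unitization_unital.
by move=> a /unitization_unital; exact: uE.
Qed.

Lemma unital_ext (l : bounded_op H -> X -> X) : left_unital_ext A l = l.
Proof.
by apply/funext => c; apply/funext => x; rewrite /left_unital_ext asboolT//; exists u.
Qed.

Lemma unit_rnorm : rnorm u <= 1.
Proof.
have [uA _] := Au.
have eu : e t @[t --> tails I] --> u.
  apply/rnorm_cvgP => eps /(cai_mull e_cai uA); apply: filterS => t.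
  by rewrite (jordan_unit_mul Au (cai_mem e_cai t)).2.
rewrite -[u]subr0; apply: (rnorm_limit_le eu); apply: nearW => t.
by rewrite subr0; exact: (cai_rnorm e_cai).
Qed.

Lemma unit_embed (D : cstarAlgType R) (j : bounded_op H -> D) a :
  jordan_embedding (unitization A) j -> A a ->
  cmul (j u) (j a) = j a /\ cmul (j a) (j u) = j a.
Proof.
case: Au => uA uE [_ _ jJ] Aa; apply: jordan_unit_cmul.
  by rewrite /jordan -jJ ?uE//; exact/unitization_unital.
by rewrite /jordan -jJ ?uE//; exact/unitization_unital.
Qed.

Section UnitActs.
Variables (l : bounded_op H -> X -> X) (lA : left_premodule A l).
Hypothesis el : forall x, l (e t) x @[t --> tails I] --> x.
Hypothesis lu : forall t x, l u (l (e t) x) = l (e t) x.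

(** [l u] is continuous and fixes the range of each [l (e t)]. *)
Lemma unit_act x : l u x = x.
Proof.
have [uA _] := Au.
apply/eqP; rewrite -subr_eq0; apply/eqP/rnorm0_eq0/eqP.
rewrite eq_le rnorm_ge0 andbT; apply/ler_addgt0Pr => eps eps0; rewrite add0r.
have e2 : 0 < eps / 2 by rewrite divr_gt0.
have /rnorm_cvgP /(_ _ e2) ex := @el x.
have [t xt] := @filter_ex _ (tails I) _ _ ex.
rewrite (le_trans (rdistD (l (e t) x) _ _))// [leRHS]splitr lerD//; last first.
  by rewrite rdistC.
rewrite -{1}lu.
have -> : l u x - l u (l (e t) x) = l u (x - l (e t) x).
  have [ll _ _] := lA.
  by rewrite (addrC x) -(scaleN1r (l (e t) x)) (ll u uA) scaleN1r addrC.
rewrite (le_trans (rnorm_act lA _ uA))// (le_trans _ xt)//.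
by rewrite ler_piMl ?rnorm_ge0 ?unit_rnorm.
Qed.

Lemma unit_actZ z x : l (z *: u) x = z *: x.
Proof.
have [uA _] := Au; have [_ lD _] := lA.
have l0 : l 0 x = 0.
  have := lD 1 0 0 x (jalg0 AJ) (jalg0 AJ); rewrite !scale1r addr0.
  by rewrite -{1}[l 0 x]addr0 => /addrI <-.
by have := lD z u 0 x uA (jalg0 AJ); rewrite addr0 l0 addr0 unit_act.
Qed.

End UnitActs.

(** The factor is [rho] times the unit; [rho ^+ k] has to exceed the norm of [b]
    when that is below [1]. *)
Lemma unital_factors (P : bounded_op H -> X -> X) (k : nat) (b : X) :
  (k <= 2)%N -> (forall (t : R) x, P (t%:C *: u) x = (t ^+ k)%:C *: x) ->
  factors A u P b.
Proof.
move=> k2 Pu; have [uA _] := Au.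
have [rho [rho0 rho1 rhob]] := shrinking_factor (rnorm_ge0 b).
exists (P ((rho^-1)%:C *: u) b), (rho%:C *: u); split.
- split; first exact: (jalgZ AJ).
    rewrite rnormZ gtr0_norm// (le_lt_trans _ rho1)//.
    by rewrite ler_piMr ?(ltW rho0) ?unit_rnorm.
  have -> : u - rho%:C *: u = (1 - rho)%:C *: u.
    by rewrite rmorphB scalerBl scale1r.
  rewrite rnormZ ger0_norm; last by rewrite subr_ge0 ltW.
  by have := unit_rnorm; have := rnorm_ge0 u; nra.
- rewrite !Pu scalerA -rmorphM -exprMn mulfV ?gt_eqF//.
  by rewrite expr1n scale1r.
- move=> /rhob h; rewrite Pu rnormZ ger0_norm ?exprn_ge0 ?invr_ge0 ?(ltW rho0)//.
  apply: le_lt_trans h; rewrite ler_wpM2r ?rnorm_ge0//.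
  by rewrite ler_weXn2l// -[leLHS]invr1 lef_pV2 ?posrE// ltW.
- move=> eps eps0; exists ((rho^-1)%:C *: u); first exact: (jalgZ AJ).
  by rewrite subrr rnorm0 ltW.
Qed.

End Unital.

(** * The factorization theorem *)

Lemma factors_frakF (R : realType) (H : hilbertType R)
    (X : completeNormedModType R[i]) (A : set (bounded_op H))
    (u : bounded_op H) (P Q : bounded_op H -> X -> X) (b : X) :
  is_jordan_unit (unitization A) u -> (forall c x, A c -> P c x = Q c x) ->
  factors A u P b ->
  exists (b0 : X) (a : bounded_op H),
    [/\ frakF A a, b = Q a b0, (`|b| < 1 -> `|b0| < 1 /\ `|a| < 1) &
        closure [set Q c b | c in A] b0].
Proof.
move=> Uu PQ [b0 [a [[Aa a1 ua] Pab nb b0b]]]; exists b0, a; split.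
- by split=> //; exists u; split=> //; rewrite rnormE lecR.
- by rewrite -PQ.
- by rewrite !rnormE !ltcR => /nb.
- apply: rnorm_closureP => eps /b0b[c Ac bc].
  by exists (Q c b); [exists c|rewrite -PQ].
Qed.

Theorem theorem2p17 (R : realType) (H : hilbertType R)
    (A : set (bounded_op H))
    (A_jordan : jordan_operator_algebra A)
    (A_approx_unital : approximately_unital A)
    (X : completeNormedModType R[i]) :
  (forall l : bounded_op H -> X -> X, nondegenerate_left_module A l ->
    forall b : X, exists (b0 : X) (a : bounded_op H),
      [/\ frakF A a,
          b = l a b0,
          (`|b| < 1 -> `|b0| < 1 /\ `|a| < 1) &
          closure [set l c b | c in A] b0])
  /\
  (forall (l : bounded_op H -> X -> X) (r : X -> bounded_op H -> X),
    nondegenerate_bimodule A l r ->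
    forall b : X, exists (b0 : X) (a : bounded_op H),
      [/\ frakF A a,
          b = r (l a b0) a,
          (`|b| < 1 -> `|b0| < 1 /\ `|a| < 1) &
          closure [set r (l c b) c | c in A] b0]).
Proof.
split=> [l|l r].
  move=> [lA [I [e [e_cai el]]] [D [j [jU lj]]]] b.
  have [[u Au]|A_nonunital] := pselect (unital A).
    apply: (@factors_frakF _ _ _ A u l l) => //.
      exact: (unital_unit_unitization Au).
    apply: (unital_factors A_jordan Au e_cai (k := 1)) => // t x.
    rewrite expr1; apply: (unit_actZ A_jordan Au e_cai lA el) => s y.
    have lE := unital_ext Au l.
    apply: esym; have := lj u [:: e s] (e s) y; rewrite /= lE; apply=> //.
    + move=> c; rewrite !inE => /orP[] /eqP->; apply/(unitization_unital Au).
        by case: Au.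
      exact: (cai_mem e_cai).
    + exact/(unitization_unital Au)/(cai_mem e_cai).
    + by rewrite (unit_embed Au jU (cai_mem e_cai s)).1.
  apply: (@factors_frakF _ _ _ A 1 (left_unital_ext A l) l).
  - exact: (unitization_unit A_jordan A_nonunital).
  - by move=> c x; exact: (ext_mem A_jordan A_nonunital).
  apply: (cohen_factorization A_jordan A_nonunital e_cai).
  apply: (ext_factorizing A_jordan A_nonunital e_cai lA el).
  exact: (left_multiplicative_palindromic A_jordan A_nonunital jU lj).
move=> [[lA rA lr] [I [e [e_cai elr]]] [D [j [jU lj rj]]]] b.
have el x : l (e t) x @[t --> tails I] --> x by case: (elr x).
have er x : r x (e t) @[t --> tails I] --> x by case: (elr x).
pose r' := fun (a : bounded_op H) x => r x a.
have [[u Au]|A_nonunital] := pselect (unital A).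
  have lE := unital_ext Au l; have rE := unital_ext Au r'.
  have Ue s := (unitization_unital Au (e s)).2 (cai_mem e_cai s).
  have Uu : unitization A u by apply/(unitization_unital Au); case: Au.
  have lu s y : l u (l (e s) y) = l (e s) y.
    apply: esym; have := lj u [:: e s] (e s) y; rewrite /= lE; apply=> //.
    + by move=> c; rewrite !inE => /orP[] /eqP->.
    + by rewrite (unit_embed Au jU (cai_mem e_cai s)).1.
  have ru s y : r' u (r' (e s) y) = r' (e s) y.
    apply: esym; have := rj (e s) [:: u] (e s) y.
    rewrite /= /right_unital_ext -/r' rE; apply=> //.
    + by move=> c; rewrite !inE => /orP[] /eqP->.
    + by rewrite (unit_embed Au jU (cai_mem e_cai s)).2.
  pose P c x := r (l c x) c.
  apply: (@factors_frakF _ _ _ A u P P) => //.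
    exact: (unital_unit_unitization Au).
  apply: (unital_factors A_jordan Au e_cai (k := 2)) => // t x.
  rewrite /P (unit_actZ A_jordan Au e_cai lA el lu).
  rewrite (unit_actZ A_jordan Au e_cai rA er ru).
  by rewrite scalerA -rmorphM expr2.
apply: (@factors_frakF _ _ _ A 1
  (fun c x => left_unital_ext A r' c (left_unital_ext A l c x))
  (fun c x => r (l c x) c)).
- exact: (unitization_unit A_jordan A_nonunital).
- by move=> c x Ac; rewrite !(ext_mem A_jordan A_nonunital).
apply: (cohen_factorization A_jordan A_nonunital e_cai).
apply: (ext2_factorizing A_jordan A_nonunital e_cai lA rA _ el er).
- by move=> a c x Aa Ac; rewrite /r' lr.
- exact: (left_multiplicative_palindromic A_jordan A_nonunital jU lj).
- exact: (right_multiplicative_palindromic A_jordan A_nonunital jU rj).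
Qed.
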